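(* Let $k$ be an odd positive integer, let $\ell$ be a positive integer and let $m$ be a nonnegative integer with $m\leq k$. Let $0<i_1<i_2<\dotsb<i_m<\ell$ be integers, and suppose the caterpillar tree $CP_\ell^{i_1,i_2,\dotsc,i_m}$ is not $CP_4^{1,3}$. Then $CP_\ell^{i_1,i_2,\dotsc,i_m}$ can be embedded in $K_k^*$ if and only if $\ell+m\leq\binom{k+1}{2}$.
   Context: $K_k^*$ denotes the complete graph $K_k$ on vertices $v_0,\dotsc,v_{k-1}$ with a loop $v_iv_i$ added at every vertex; it has $\binom{k+1}{2}$ edges. An embedding of a graph $G$ (simple graph possibly with at most one loop per vertex) in $K_k^*$ is a map $f:V(G)\to V(K_k^* )$ such that each edge $uv$ of $G$ is sent to the edge $f(u)f(v)$ of $K_k^*$ (a loop if $f(u)=f(v)$), and the induced map $E(G)\to E(K_k^* )$ is injective. For a positive integer $\ell$, a nonnegative integer $m$ and integers $0<i_1\leq\dotsb\leq i_m<\ell$, the caterpillar tree $CP_\ell^{i_1,\dotsc,i_m}$ is the tree with vertices $y_0,\dotsc,y_{\ell+m}$ consisting of the path $y_0y_1\dotsb y_\ell$ together with the $m$ extra edges $y_{\ell+1}y_{i_1},y_{\ell+2}y_{i_2},\dotsc,y_{\ell+m}y_{i_m}$. *)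

(* Defs.v *)
From HB Require Import structures.
From mathcomp Require Import all_boot.

Set Implicit Arguments.
Unset Strict Implicit.
Unset Printing Implicit Defensive.

(* A graph, possibly with loops, is a symmetric relation on its vertex type.
   An edge uv is the set [set u; v], so that a loop vv is the singleton. *)
Definition edges (T : finType) (e : rel T) : {set {set T}} :=
  [set [set p.1; p.2] | p in [set p : T * T | e p.1 p.2]].

Definition is_embedding (T U : finType) (e : rel T) (h : rel U) (f : T -> U)
    : Prop :=
  {homo f : u v / e u v >-> h u v} /\
  {in edges e &, injective (fun E : {set T} => f @: E)}.

Definition embeddable (T U : finType) (e : rel T) (h : rel U) : Prop :=
  exists f : T -> U, is_embedding e h f.

Definition Kstar (k : nat) : rel 'I_k := fun _ _ => true.
Arguments Kstar k _ _ : clear implicits.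

(* Indices of [i] start at 0: [tnth i j] is the attachment point of the leg
   ending at y_(l + j.+1). *)
Definition caterpillar_arc (l m : nat) (i : m.-tuple nat) : rel nat :=
  fun a b =>
    ((a < l) && (b == a.+1))
    || [exists j : 'I_m, (a == l + j.+1) && (b == tnth i j)].

Definition caterpillar (l m : nat) (i : m.-tuple nat) : rel 'I_(l + m).+1 :=
  fun x y => caterpillar_arc l i x y || caterpillar_arc l i y x.
Arguments caterpillar l {m} i _ _.

(* Main.v *)
Require Import Defs.
From Stdlib Require Import Ascii String.
From HB Require Import structures.
From mathcomp Require Import all_boot zify.

Set Implicit Arguments.
Unset Strict Implicit.
Unset Printing Implicit Defensive.

(** Only the extremal case l + m = C(k+1, 2) matters, since the path may be
    lengthened. There the legs are taken to be loops: if an Eulerian circuit of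
    K_k visits k distinct vertices at k prescribed positions, then the loops at
    these vertices can either serve as legs or, wherever two consecutive
    positions of the longer path carry no leg, be traversed by the path.

    For odd k >= 7 such a circuit exists for every choice of k positions. The
    induction from k = 2h - 1 to k + 2 finds, by averaging, 4h + 3 consecutive
    positions that start with a marked one and contain exactly five marks. An
    Eulerian circuit of K_(k+2) arises from one of K_k by splicing into these
    positions closed trails through the two new vertices a and b; two of the
    five marks fall on a and b, and the other three on vertices distinguished
    in K_k. Inside a splice the walk a, u, b, u', a may replace a visit to a,
    which lengthens one gap between marks by 4 and adds two vertices to K_k, so
    finitely many splices, indexed by the gaps modulo 4, suffice.

    For k = 5 there are 20 sets of positions without such a circuit; the
    corresponding caterpillars need legs that are not loops. *)

(** * Windows of a cyclic marking *)

Lemma nth_rot_mod (m : bitseq) n i : n <= size m -> i < size m ->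
  nth false (rot n m) i = nth false m ((n + i) %% size m).
Proof.
move=> le_n lt_i; rewrite /rot nth_cat size_drop nth_drop.
case: ltnP => Hi; first by rewrite modn_small //; lia.
rewrite nth_take; last by lia.
have -> : n + i = (i - (size m - n)) + size m by lia.
by rewrite modnDr modn_small //; lia.
Qed.

(* The mean count over all windows lies in (c, c.+1], and sliding a window by
   one position changes its count by at most one, which drops only when the
   position left behind is marked. *)
Lemma exists_window c W (m : bitseq) : W <= size m ->
    c * size m < W * count id m -> W * count id m <= c.+1 * size m ->
  exists2 n, n < size m &
    nth false (rot n m) 0 && (count id (take W (rot n m)) == c.+1).
Proof.
set N := size m; set K := count id m => leWN ltc lec.
have N_gt0 : 0 < N.
  by rewrite lt0n; apply/eqP=> N0; move: (count_size id m); rewrite -/K -/N; nia.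
pose f i : nat := nth false m (i %% N).
pose w j := \sum_(0 <= i < W) f (j + i).
have fN i : f (i + N) = f i by rewrite /f modnDr.
have wN j : w (j + N) = w j.
  by apply: eq_bigr => i _; rewrite addnAC fN.
have wS j : w j.+1 + f j = w j + f (j + W).
  have := erefl (\sum_(0 <= i < W.+1) f (j + i)).
  rewrite {1}big_nat_recl // big_nat_recr //= addn0 -/(w j) => <-.
  by rewrite addnC; congr (_ + _); apply: eq_bigr => i _; rewrite addnS addSn.
have sumf i : \sum_(0 <= j < N) f (j + i) = K.
  elim: i => [|i IH].
    rewrite /K -sumn_count sumnE big_map (big_nth false) -/N.
    rewrite big_seq [RHS]big_seq; apply: eq_bigr => j.
    by rewrite mem_index_iota /f addn0 => /andP[_ /modn_small ->].
  rewrite -IH; have := erefl (\sum_(0 <= j < N.+1) f (j + i)).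
  rewrite {1}big_nat_recl // big_nat_recr //= add0n [N + i]addnC fN addnC => /addIn <-.
  by apply: eq_bigr => j _; rewrite addnS addSn.
(* Double counting: each position lies in exactly [W] of the [N] cyclic windows. *)
have sumw : \sum_(0 <= j < N) w j = W * K.
  rewrite exchange_big /= (eq_bigr (fun=> K)); last by move=> i _; exact: sumf.
  by rewrite sum_nat_const_nat subn0.
suff [j fj /eqP wj] : exists2 j, f j = 1 & w j == c.+1.
  have lt_jN : j %% N < N by rewrite ltn_mod.
  exists (j %% N) => //; rewrite nth_rot_mod ?(ltnW lt_jN) // addn0 modn_mod.
  move: (fj); rewrite /f; case: (nth _ _ _) => //= _.
  apply/eqP; rewrite -wj -sumn_count sumnE big_map (big_nth false).
  rewrite size_takel ?size_rot // big_seq [RHS]big_seq; apply: eq_bigr => i.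
  rewrite mem_index_iota => /andP[_ lt_iW].
  rewrite nth_take // nth_rot_mod ?(ltnW lt_jN) ?(leq_trans lt_iW) //.
  by rewrite /f -/N modnDml.
have [j0 wj0] : exists j, c < w j.
  have [/hasP[j _ Hj]|/hasPn H] := boolP (has (fun j => c < w j) (index_iota 0 N)).
    by exists j.
  have : \sum_(0 <= j < N) w j <= \sum_(0 <= j < N) c.
    by rewrite big_seq [leqRHS]big_seq; apply: leq_sum => j /H; rewrite -leqNgt.
  by rewrite sumw sum_nat_const_nat subn0; lia.
(* If some window has at most [c] marks, slide from [j0] to the first such window: the one just
   before it has [c.+1] marks and loses a marked position. The offset used below only needs to lead
   from [j0] to a position congruent to [j1] modulo [N]. *)
have [/hasP[j1 _ wj1]|/hasPn H] := boolP (has (fun j => w j <= c) (index_iota 0 N)).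
  have exP : exists i, w (j0 + i) <= c.
    exists (j1 + j0 * N - j0).
    have -> : j0 + (j1 + j0 * N - j0) = j1 + j0 * N by nia.
    by elim: (j0) => [|i IH]; rewrite ?mul0n ?addn0 // mulSn addnCA addnC wN.
  case: (ex_minnP exP) => [[|i] Hi Hmin]; first by rewrite addn0 in Hi; lia.
  have Hi' : c < w (j0 + i) by rewrite ltnNge; apply/negP=> /Hmin; rewrite ltnn.
  exists (j0 + i); move: (wS (j0 + i)); rewrite addnS in Hi; move: Hi Hi';
    rewrite /f; case: (nth _ _ _); case: (nth _ _ _) => /=; lia.
(* Otherwise all windows have more than [c] marks; as the mean is at most [c.+1], each has exactly
   [c.+1], and any marked start will do. *)
have [j fj] : exists2 j, j < N & f j = 1.
  have : has id m by rewrite has_count -/K; nia.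
  case/(has_nthP false)=> j lt_j Hj; exists j => //.
  by rewrite /f modn_small // Hj.
exists j => //; rewrite eqn_leq andbC.
have H' i : i < N -> c < w i.
  by move=> lt_i; rewrite ltnNge; apply: H; rewrite mem_index_iota.
rewrite H' //= leqNgt; apply/negP=> wj.
suff : \sum_(0 <= j < N) c.+1 < \sum_(0 <= j < N) w j.
  by rewrite sumw sum_nat_const_nat subn0; lia.
rewrite !big_mkord [ltnLHS](bigD1 (Ordinal fj)) // [ltnRHS](bigD1 (Ordinal fj)) //=.
by rewrite -addSn leq_add // leq_sum // => i _; exact: H'.
Qed.

(** A marking described by its gaps: an entry [d] stands for a gap of [d.+1], from a mark up to the
    next one. *)
Definition blocks (ds : seq nat) : bitseq :=
  flatten [seq true :: nseq d false | d <- ds].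

Lemma blocks_exists (m : bitseq) : nth false m 0 ->
  exists2 ds, size ds = count id m & m = blocks ds.
Proof.
case: m => // b t /= ->; rewrite add1n.
elim: t => [|[] t [ds Sds Eds]]; first by exists [:: 0].
  by exists (0 :: ds); rewrite /= ?Sds // /blocks /= -/(blocks ds) -Eds.
case: ds Sds Eds => // d ds /= [Sds] [Eds].
by exists (d.+1 :: ds); rewrite /= ?Sds // Eds.
Qed.

(** * Splicing two new vertices into a circuit *)

Definition edge (u v : nat) : nat * nat := (minn u v, maxn u v).

Lemma edgeC u v : edge u v = edge v u.
Proof. by rewrite /edge minnC maxnC. Qed.

Lemma edge_inj u v u' v' : edge u v = edge u' v' ->
  (u = u' /\ v = v') \/ (u = v' /\ v = u').
Proof. by move=> [] *; lia. Qed.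

Lemma edge_lt u v : u != v -> (edge u v).1 < (edge u v).2.
Proof. by rewrite /edge /=; lia. Qed.

(** [x] is a closed walk; its closing edge, from the last vertex to the first, comes first in the
    list. *)
Definition cedges (x : seq nat) := pairmap edge (last 0 x) x.

Definition strict (es : seq (nat * nat)) := all (fun e => e.1 < e.2) es.

(** Since the 'C(k, 2) edges are distinct and loopless on k vertices, every edge of K_k occurs
    exactly once: these are the Eulerian circuits of K_k. *)
Definition circuit k x :=
  [&& size x == 'C(k, 2), all (gtn k) x, strict (cedges x) & uniq (cedges x)].

(* Letters of a splice: 0, .., 4 stand for the first five vertices x_0, .., x_4
   of a circuit of K_k, 5 and 6 for the two new vertices (the hubs), and 7 + i
   for further vertices of K_k, each visited once. *)
Definition hub c := (c == 5) || (c == 6).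
Definition hub_edge (e : nat * nat) := hub e.1 || hub e.2.

(* The splice replaces x_0, .., x_3 and is followed by x_4. *)
Definition tedges w := pairmap edge (head 0 w) (behead (rcons w 4)).

(* A sufficient condition for x_i and x_j to be distinct: two steps of a circuit
   never return to their origin, and marked vertices differ. *)
Definition apart (b : bitseq) i j :=
  [|| i == j, j <= i.+2 | nth false b i && nth false b j].

(* A splice is cut into blocks [vs] whose first letters are the marked
   positions; [b] marks those of x_0, .., x_3 that are to be marked in the
   circuit of K_k, [T] lists the x_j having an edge to a hub. *)
Definition template (b : bitseq) (T : seq nat) n (vs : seq (seq nat)) :=
  let es := tedges (flatten vs) in
  let D := [:: 5, 6 & T ++ iota 7 n] in
  [/\ [&& all (fun v => v != [::]) vs, head 0 (head [::] vs) == 0,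
          size b == 4, count id b == 3, vs != [::] &
          all (gtn (7 + n)) (flatten vs)],
      uniq es /\ strict es,
      perm_eq [seq e <- es | ~~ hub_edge e] [:: (0, 1); (1, 2); (2, 3); (3, 4)]
        /\ all (fun e => (e.1 \in D) && (e.2 \in D)) [seq e <- es | hub_edge e],
      all (gtn 5) T /\ allrel (fun i j => (i <= j) ==> apart b i j) T T &
      perm_eq [seq head 0 v | v <- vs] [:: 5, 6 & mask b (iota 0 4)]].

Lemma pairmap_map (T1 T2 : Type) (h : T1 -> T2) (f : T1 -> T1 -> nat * nat)
    (g : T2 -> T2 -> nat * nat) vf :
    (forall u v, g (h u) (h v) = vf (f u v)) ->
  forall (s : seq T1) u, pairmap g (h u) (map h s) = map vf (pairmap f u s).
Proof. by move=> H; elim=> //= v s IH u; rewrite H IH. Qed.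

Lemma mask_blocks (f : nat -> nat) (vs : seq (seq nat)) :
    all (fun v => v != [::]) vs ->
  mask (blocks [seq (size v).-1 | v <- vs]) (map f (flatten vs)) =
  [seq f (head 0 v) | v <- vs].
Proof.
elim: vs => [|[|c v] vs IH] //= Hvs; rewrite /blocks /= -/(blocks _).
by rewrite map_cat mask_cat ?size_nseq ?size_map // mask_false IH.
Qed.

Lemma mem_mask_nth (T : eqType) (x0 : T) m s i :
  i < size s -> nth false m i -> nth x0 s i \in mask m s.
Proof.
elim: s m i => [|v s IH] [|c m] [|i] //=; first by case: c; rewrite ?inE ?eqxx.
by move=> lt_i Hi; case: c; rewrite ?inE IH ?orbT.
Qed.

Lemma mask_uniq_inj (T : eqType) (x0 : T) m s i j : uniq (mask m s) ->
    i < size s -> j < size s -> nth false m i -> nth false m j ->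
  nth x0 s i = nth x0 s j -> i = j.
Proof.
elim: s m i j => [|v s IH] [|c m] [|i] [|j] //=.
- case: c => //= /andP[vNin _] _ lt_j _ mj E; case/negP: vNin.
  by rewrite E mem_mask_nth.
- case: c => //= /andP[vNin _] lt_i _ mi _ E; case/negP: vNin.
  by rewrite -E mem_mask_nth.
- by move=> Hu lt_i lt_j mi mj /(IH m) ->; case: (c) Hu => //= /andP[].
Qed.

(** Neighbours differ because there are no loops; vertices two apart differ because otherwise the
    two edges between them would coincide. *)
Lemma strict_nth_neq x : strict (cedges x) -> uniq (cedges x) ->
  forall i j, i < j < size x -> j <= i.+2 -> nth 0 x i <> nth 0 x j.
Proof.
rewrite /cedges /strict; move: (last 0 x) => u; elim: x u => [|v x IH] u //=.
  by move=> _ _ i j; rewrite andbF.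
move=> /andP[_ Hs] /andP[_ Hu] [|i] [|j] //=; last exact: IH Hs Hu _ _.
case: j => [|[|j]] //; case: x Hs Hu {IH} => [|v1 [|v2 x]] //= Hs Hu _ _ E.
- by move: Hs; rewrite E /edge minnn maxnn /= ltnn.
- by move: Hs; rewrite E /edge minnn maxnn /= ltnn.
- by move: Hu; rewrite E edgeC inE eqxx.
Qed.

Lemma pairmap_edge_lt k u s : all (gtn k) (u :: s) ->
  all (fun e => e.2 < k) (pairmap edge u s).
Proof.
elim: s u => //= c s IH u /and3P[lt_u lt_c Hs].
by rewrite /edge /= gtn_max lt_u lt_c IH //= lt_c.
Qed.

(** The new closed walk keeps the edges of [x] and adds the hub edges. The latter are new because
    they have an endpoint at least [k], and pairwise distinct because letters on hub edges name
    distinct vertices. The marked vertices are those marked in [x] and the two hubs. *)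
Lemma template_expand k b T n vs x m :
    template b T n vs -> size T + n <= k ->
    circuit k x -> 4 < size x -> size (b ++ m) = size x ->
    uniq (mask (b ++ m) x) ->
  exists y, [/\ size y + 4 = size (flatten vs) + size x, all (gtn k.+2) y,
    strict (cedges y), uniq (cedges y) &
    uniq (mask (blocks [seq (size v).-1 | v <- vs] ++ m) y)].
Proof.
move=> [/and5P[vs_ne head_vs /eqP size_b _ /andP[nvs w_lt]] [es_uniq es_strict]
  [path_es hub_es] [T_lt T_apart] heads].
move=> leTn /and4P[_ x_lt x_strict x_uniq] x_size.
rewrite size_cat size_b => size_m.
case: x x_lt x_strict x_uniq x_size size_m => [|x0 [|x1 [|x2 [|x3 [|x4 xr]]]]] // x_lt.
set x := x0 :: _ => x_strict x_uniq _ size_m rainbow.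
(* The supply for the fresh letters: vertices of K_k that no letter of [T] names. The bound on
   [size T + n] makes it large enough. *)
pose us := [seq v <- iota 0 k | v \notin [seq nth 0 x i | i <- T]].
have us_size : n <= size us.
  pose p := mem [seq nth 0 x i | i <- T].
  have : size (filter p (iota 0 k)) <= size T.
    rewrite -(size_map (nth 0 x) T) uniq_leq_size ?filter_uniq ?iota_uniq //.
    by move=> v; rewrite mem_filter => /andP[].
  have := count_predC p (iota 0 k); rewrite size_iota !size_filter => Ek le_p.
  rewrite -(leq_add2l (size T)) (leq_trans leTn) // -{1}Ek.
  by rewrite leq_add2r.
have us_uniq : uniq us by rewrite filter_uniq ?iota_uniq.
pose val c := if c < 5 then nth 0 x c else
  if c == 5 then k else if c == 6 then k.+1 else nth 0 us (c - 7).
have val_lt c : c < 5 -> val c < k.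
  move=> lt_c; rewrite /val lt_c; apply: (allP x_lt); rewrite mem_nth //.
  exact: leq_trans lt_c _.
have us_mem i : i < n -> nth 0 us i \in us.
  by move=> lt_i; rewrite mem_nth // (leq_trans lt_i).
pose D := [:: 5, 6 & T ++ iota 7 n].
have x_ne : forall i j, i < j < 5 -> j <= i.+2 -> nth 0 x i <> nth 0 x j.
  move=> i j /andP[lt_ij lt_j]; apply: (strict_nth_neq x_strict x_uniq).
  by rewrite lt_ij (leq_trans lt_j).
(* Injectivity is claimed only for letters that may lie on hub edges; other letters may name the
   same vertex of the circuit. *)
have val_inj : {in D &, injective val}.
  have T5 i : i \in T -> i < 5 by move/(allP T_lt).
  have valT i : i \in T -> val i \in [seq nth 0 x i | i <- T].
    by move=> iT; rewrite /val T5 // map_f.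
  have valU i : 7 <= i < 7 + n -> val i \in us.
    move=> /andP[le7 lt]; rewrite /val !ifN ?us_mem //; move: le7 lt; clear; lia.
  have valUk i : 7 <= i < 7 + n -> val i < k.
    by move/valU; rewrite mem_filter mem_iota => /andP[_].
  have TU i j : i \in T -> 7 <= j < 7 + n -> val i <> val j.
    by move=> iT /valU jU E; move: jU; rewrite -E mem_filter valT.
  have UU i j : 7 <= i < 7 + n -> 7 <= j < 7 + n -> val i = val j -> i = j.
    move=> Hi Hj; rewrite /val !ifN; first last; try by move: Hi Hj; clear; lia.
    have lt_us a : 7 <= a < 7 + n -> a - 7 < size us.
      by move=> Ha; rewrite (leq_trans _ us_size) //; move: Ha; clear; lia.
    move/eqP; rewrite nth_uniq ?lt_us //; move: Hi Hj; clear; lia.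
  have TT i j : i \in T -> j \in T -> i < j -> val i <> val j.
    move=> iT jT lt_ij; rewrite /val !T5 //.
    have := allrelP T_apart _ _ iT jT; rewrite ltnW //= /apart ltn_eqF //=.
    case/orP=> [le_j|/andP[bi bj]].
      by apply: x_ne => //; rewrite lt_ij T5.
    have bm : forall i, nth false b i -> nth false (b ++ m) i.
      by move=> i'; rewrite nth_cat; case: ltnP => // le_i; rewrite nth_default.
    move=> /(mask_uniq_inj rainbow) E; suff Eij : i = j by rewrite Eij ltnn in lt_ij.
    by apply: E; rewrite ?bm //= (leq_trans (T5 _ _)).
  have TT' i j : i \in T -> j \in T -> val i = val j -> i = j.
    move=> iT jT E; case: (ltngtP i j) => // lt_ij.
      by case: (TT _ _ iT jT lt_ij).
    by case: (TT _ _ jT iT lt_ij).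
  have cls c : c \in D -> [\/ c = 5, c = 6, c \in T | 7 <= c < 7 + n].
    rewrite !inE mem_cat mem_iota => /or3P[/eqP|/eqP|/orP[]] H;
    by [constructor 1 | constructor 2 | constructor 3 | constructor 4].
  have Tk c : c \in T -> val c < k by move/T5/val_lt.
  have ne_lt c d : val c < k -> k <= val d -> val c <> val d.
    by move=> lt_c le_d E; rewrite E ltnNge le_d in lt_c.
  have v5 : val 5 = k by [].
  have v6 : val 6 = k.+1 by [].
  have le5 : k <= val 5 by rewrite v5.
  have le6 : k <= val 6 by rewrite v6.
  move=> i j /cls[->|->|iT|iU] /cls[->|->|jT|jU] E //.
  - by move/eqP: E; rewrite v5 v6 ltn_eqF.
  - by case: (ne_lt _ _ (Tk _ jT) le5).
  - by case: (ne_lt _ _ (valUk _ jU) le5).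
  - by move/esym/eqP: E; rewrite v5 v6 ltn_eqF.
  - by case: (ne_lt _ _ (Tk _ jT) le6).
  - by case: (ne_lt _ _ (valUk _ jU) le6).
  - by case: (ne_lt _ _ (Tk _ iT) le5).
  - by case: (ne_lt _ _ (Tk _ iT) le6).
  - exact: TT'.
  - by case: (TU _ _ iT jU).
  - by case: (ne_lt _ _ (valUk _ iU) le5).
  - by case: (ne_lt _ _ (valUk _ iU) le6).
  - by case: (TU _ _ jT iU).
  - exact: UU.
case: vs vs_ne head_vs es_uniq es_strict path_es hub_es heads nvs w_lt => // v vs.
set w := flatten (v :: vs) => vs_ne head_vs es_uniq es_strict path_es hub_es heads _ w_lt.
have [w' Ew] : exists w', w = 0 :: w'.
  by move: vs_ne head_vs; rewrite /w /=; case: (v) => //= c v' _ /eqP->; eexists.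
pose vedge (e : nat * nat) := edge (val e.1) (val e.2).
have vedgeE c d : edge (val c) (val d) = vedge (edge c d).
  by rewrite /vedge /edge /=; case: (leqP c d) => // _; exact: edgeC.
pose es := tedges w; rewrite -/es in es_uniq es_strict path_es hub_es.
pose y := map val w ++ x4 :: xr.
have cyE : cedges y = edge (last x4 xr) x0 :: map vedge es ++ pairmap edge x4 xr.
  rewrite /cedges /y last_cat /= Ew /=; congr (_ :: _).
  rewrite -cat_rcons -(map_rcons val w' 4) pairmap_cat last_map last_rcons.
  by rewrite (pairmap_map vedgeE) /es Ew.
have cy_perm : perm_eq (cedges y) (map vedge [seq e <- es | hub_edge e] ++ cedges x).
  have -> : cedges x = [:: edge (last x4 xr) x0] ++
      map vedge [:: (0, 1); (1, 2); (2, 3); (3, 4)] ++ pairmap edge x4 xr by [].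
  rewrite cyE -cat1s perm_sym perm_catCA perm_cat2l perm_sym catA perm_cat2r.
  rewrite -(permPl (perm_map vedge (permEl (perm_filterC hub_edge es)))).
  by rewrite map_cat perm_cat2l; apply: perm_map.
have hub_in e : e \in [seq e <- es | hub_edge e] ->
    [/\ hub_edge e, e.1 \in D, e.2 \in D & e.1 < e.2].
  move=> He; have /andP[? ?] := allP hub_es _ He.
  move: He; rewrite mem_filter => /andP[? /(allP es_strict)].
  by split.
have val_ne e : e \in [seq e <- es | hub_edge e] -> val e.1 != val e.2.
  case/hub_in=> _ D1 D2 lt_e; apply/eqP=> /val_inj E.
  by rewrite E // ltnn in lt_e.
have hub_ge e : hub_edge e -> k <= (vedge e).2.
  have hv c : hub c -> k <= val c by case/orP=> /eqP->.
  by rewrite /vedge /edge /= leq_max => /orP[] /hv ->; rewrite ?orbT.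
have x_edge_lt e : e \in cedges x -> e.2 < k.
  have : all (gtn k) (last 0 x :: x).
    apply/andP; split; [apply: (allP x_lt) | exact: x_lt].
    exact: (mem_last x0 [:: x1, x2, x3, x4 & xr]).
  by move/pairmap_edge_lt/allP; apply.
exists y; split.
- by rewrite /y size_cat size_map /=; rewrite !addnS addn0.
- have ltk2 c : c < k -> c < k.+2 by move/leq_trans; apply; rewrite leqW.
  rewrite /y all_cat; apply/andP; split; last first.
    by apply: sub_all (_ : all (gtn k) _); [move=> c /= /ltk2|];
      case/and5P: x_lt.
  rewrite all_map; apply/allP=> c /(allP w_lt) /= lt_c.
  case: (ltnP c 5) => [/val_lt /ltk2 //|le5c]; rewrite /val (leq_gtF le5c).
  case: eqP => [_|/eqP n5]; first exact: leqnSn.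
  case: eqP => [_|/eqP n6] //.
  have : nth 0 us (c - 7) \in us by apply: us_mem; move: lt_c le5c n5 n6; clear; lia.
  by rewrite mem_filter mem_iota => /and3P[_ _ /ltk2].
- rewrite /strict (perm_all _ cy_perm) all_cat; apply/andP; split => //.
  apply/allP=> _ /mapP[e He ->]; exact/edge_lt/val_ne.
- rewrite (perm_uniq cy_perm) cat_uniq x_uniq andbT; apply/andP; split.
    rewrite map_inj_in_uniq ?filter_uniq // => e e' He He'.
    have [_ D1 D2 lt_e] := hub_in _ He; have [_ D1' D2' lt_e'] := hub_in _ He'.
    case: e e' D1 D2 lt_e D1' D2' lt_e' {He He'} => [e1 e2] [f1 f2] /=.
    move=> De1 De2 lt_e Df1 Df2 lt_f /edge_inj[] [/= E1 E2].
      by rewrite (val_inj _ _ De1 Df1 E1) (val_inj _ _ De2 Df2 E2).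
    move: lt_e lt_f; rewrite (val_inj _ _ De1 Df2 E1) (val_inj _ _ De2 Df1 E2).
    by move=> /ltnW; rewrite leqNgt => /negP.
  apply/hasPn=> e /x_edge_lt; rewrite ltnNge; apply: contra => /mapP[f].
  by case/hub_in=> /hub_ge + _ _ _ ->.
have Ex : mask (b ++ m) x = map val (mask b (iota 0 4)) ++ mask m (x4 :: xr).
  by rewrite map_mask -(mask_cat _ _ (s1 := map val (iota 0 4))) ?size_map ?size_iota.
rewrite /y mask_cat; last first.
  rewrite /w /blocks size_map; elim: (v :: vs) vs_ne => [|[|c u] us' IH] //= Hus.
  by rewrite /= !size_cat size_nseq IH.
rewrite /w mask_blocks // (map_comp val).
have Hp : perm_eq [seq val i | i <- [seq head 0 u | u <- v :: vs]]
            [:: k, k.+1 & map val (mask b (iota 0 4))].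
  exact: perm_map heads.
rewrite (perm_uniq (perm_cat Hp (perm_refl (mask m (x4 :: xr))))) !cat_cons -Ex.
rewrite !cons_uniq rainbow andbT inE.
have kN c : k <= c -> c \notin mask (b ++ m) x.
  move=> le_c; apply/negP=> /mem_mask /(allP x_lt) /=.
  by rewrite ltnNge le_c.
by rewrite negb_or ltn_eqF //= !kN.
Qed.

(* The other hub is 11 - h. *)
Definition detour h n : seq nat := [:: 7 + n; 11 - h; 8 + n].
Definition detour_edges h n :=
  [:: edge h (7 + n); edge (7 + n) (11 - h); edge (11 - h) (8 + n); edge (8 + n) h].

Lemma pairmap_detour h n q :
  pairmap edge h (detour h n ++ h :: q) = detour_edges h n ++ pairmap edge h q.
Proof. by []. Qed.

Lemma tedges_detour p h q n :
  perm_eq (tedges (p ++ h :: detour h n ++ h :: q))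
          (detour_edges h n ++ tedges (p ++ h :: q)).
Proof.
case: p => [|u p].
  by rewrite /tedges -[behead _]/(detour h n ++ h :: rcons q 4) pairmap_detour.
have tE r : tedges ((u :: p) ++ h :: r) =
    pairmap edge u (rcons p h) ++ pairmap edge h (rcons r 4).
  by rewrite /tedges /= -cat_rcons rcons_cat pairmap_cat last_rcons.
by rewrite !tE rcons_cat pairmap_detour perm_catCA.
Qed.

(** The blocks that a detour can lengthen by 4: a hub inside the block takes the detour, or a hub
    opening the next block is visited once more at the end of this one. The default 4 is the letter
    after the last block, which is no hub. *)
Definition touched (vs : seq (seq nat)) i :=
  has hub (nth [::] vs i) || hub (head 4 (nth [::] vs i.+1)).

Lemma tedges_lt n w : all (gtn (7 + n)) w ->
  all (fun e => e.2 < 7 + n) (tedges w).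
Proof.
case: w => // u w; rewrite /tedges /= => /andP[lt_u lt_w].
by apply: pairmap_edge_lt; rewrite /= lt_u all_rcons lt_w.
Qed.

Lemma detour_edgesE h n : hub h -> detour_edges h n =
  [:: (h, 7 + n); (11 - h, 7 + n); (11 - h, 8 + n); (h, 8 + n)].
Proof.
have E a b : a < b -> edge a b = (a, b).
  by rewrite /edge => /ltnW le_ab; rewrite (minn_idPl le_ab) (maxn_idPr le_ab).
move=> hub_h; rewrite /detour_edges [edge (7 + n) _]edgeC [edge (8 + n) _]edgeC.
by case/orP: hub_h => /eqP->; rewrite !E // !addSn !ltnS.
Qed.

Lemma detour_edges_uniq h n : hub h -> uniq (detour_edges h n).
Proof.
move=> hub_h; rewrite detour_edgesE //= !inE !xpair_eqE !eqn_add2r !eqxx /=.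
by case/orP: hub_h => /eqP->.
Qed.

Lemma detour_edges_hub h n : hub h ->
  all (fun e => [&& e.1 < e.2, hub e.1, 7 + n <= e.2 & e.2 < 7 + n.+2])
    (detour_edges h n).
Proof.
move=> hub_h; rewrite detour_edgesE //= !addSn !addnS !ltnS !leqnn !leqnSn.
by case/orP: hub_h => /eqP->.
Qed.

(** The four added edges each join a hub to one of the letters [7 + n] and [8 + n], which are new,
    so they repeat no edge and leave the old path edges and the block heads alone. *)
Lemma template_insert b T n vs1 v v' vs2 h :
    hub h -> head 0 v' = head 0 v -> v != [::] -> v' != [::] ->
    perm_eq (flatten (vs1 ++ v' :: vs2)) (h :: detour h n ++ flatten (vs1 ++ v :: vs2)) ->
    perm_eq (tedges (flatten (vs1 ++ v' :: vs2)))
            (detour_edges h n ++ tedges (flatten (vs1 ++ v :: vs2))) ->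
  template b T n (vs1 ++ v :: vs2) -> template b T n.+2 (vs1 ++ v' :: vs2).
Proof.
move=> hub_h head_v' v_ne v'_ne perm_w perm_es.
set w := flatten _ in perm_w perm_es *.
set w0 := flatten _ in perm_w perm_es *.
move=> [/and5P[vs_ne head_vs sb cb /andP[_ w_lt]] [es_uniq es_strict]
  [path_es hub_es] T_ok heads].
have es_lt : all (fun e => e.2 < 7 + n) (tedges w0) by exact: tedges_lt.
have det_lt := detour_edges_hub n hub_h.
split.
- apply/and5P; split=> //.
  + by move: vs_ne; rewrite !all_cat /= v_ne v'_ne.
  + by move: head_vs; case: (vs1) => //=; rewrite head_v'.
  apply/andP; split; first by case: (vs1).
  rewrite (perm_all _ perm_w) -cat_cons all_cat; apply/andP; split.
    by rewrite /= !addSn !addnS !ltnS; case/orP: hub_h => /eqP->; rewrite ?leqnn ?leqnSn.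
  by apply: sub_all w_lt => c /= /leq_trans; apply; rewrite leq_add2l; apply/ltnW/ltnW.
- split; last first.
    rewrite /strict (perm_all _ perm_es) all_cat [all _ (tedges _)]es_strict andbT.
    by apply: sub_all det_lt => e /andP[].
  rewrite (perm_uniq perm_es) cat_uniq detour_edges_uniq // es_uniq andbT.
  apply/hasPn=> e He; apply/negP=> /(allP det_lt) /and4P[_ _ le_e _].
  by move/(allP es_lt): He; rewrite ltnNge le_e.
- split.
    rewrite (perm_trans (perm_filter _ perm_es)) // filter_cat.
    rewrite (eq_in_filter (a2 := pred0)) ?filter_pred0 // => e.
    by move/(allP det_lt) => /and4P[_ hub_e _ _]; rewrite /hub_edge hub_e.
  rewrite (perm_all _ (perm_filter hub_edge perm_es)) filter_cat all_cat.
  apply/andP; split.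
    apply/allP=> e; rewrite mem_filter => /andP[_] /(allP det_lt).
    case/and4P=> _ hub_e le_e lt_e; rewrite !inE !mem_cat !mem_iota lt_e.
    rewrite (leq_trans (leq_addr n 7) le_e) !orbT andbT.
    by rewrite orbA -[_ || (e.1 == 6)]/(hub e.1) hub_e.
  have iotaS c : c \in iota 7 n -> c \in iota 7 n.+2.
    rewrite !mem_iota => /andP[-> /leq_trans]; apply.
    by rewrite leq_add2l; apply/ltnW/ltnW.
  have DS c : c \in [:: 5, 6 & T ++ iota 7 n] -> c \in [:: 5, 6 & T ++ iota 7 n.+2].
    by rewrite !inE !mem_cat => /or3P[->|->|/orP[->|/iotaS ->]]; rewrite ?orbT.
  by apply: sub_all hub_es => e /andP[/DS -> /DS ->].
- by [].
by move: heads; rewrite !map_cat /= head_v'.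
Qed.

Lemma template_extend b T n vs i :
    template b T n vs -> i < size vs -> touched vs i ->
  exists vs', [/\ template b T n.+2 vs', size vs' = size vs,
    forall j, size (nth [::] vs' j) = size (nth [::] vs j) + 4 * (j == i) &
    forall j, touched vs j -> touched vs' j].
Proof.
move=> tmpl lt_i touched_i.
pose v := nth [::] vs i; pose vs1 := take i vs; pose vs2 := drop i.+1 vs.
have Evs : vs = vs1 ++ v :: vs2 by rewrite -drop_nth // cat_take_drop.
have size_vs1 : size vs1 = i by rewrite size_takel // ltnW.
have vs_ne : all (fun v => v != [::]) vs by case: tmpl => /and5P[].
have v_ne : v != [::] by apply: (allP vs_ne); exact: mem_nth.
have conclude h v' : hub h -> head 0 v' = head 0 v -> v' != [::] ->
    size v' = size v + 4 -> has hub v' ->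
    perm_eq (flatten (vs1 ++ v' :: vs2)) (h :: detour h n ++ flatten (vs1 ++ v :: vs2)) ->
    perm_eq (tedges (flatten (vs1 ++ v' :: vs2)))
            (detour_edges h n ++ tedges (flatten (vs1 ++ v :: vs2))) ->
  exists vs', [/\ template b T n.+2 vs', size vs' = size vs,
    forall j, size (nth [::] vs' j) = size (nth [::] vs j) + 4 * (j == i) &
    forall j, touched vs j -> touched vs' j].
  move=> hub_h head_v' v'_ne size_v' has_v' perm_w perm_es.
  have nthE j : nth [::] (vs1 ++ v' :: vs2) j = if j == i then v' else nth [::] vs j.
    rewrite Evs !nth_cat size_vs1; case: (ltngtP j i) => // [lt_ij|->].
      by rewrite -(subnKC lt_ij) addSnnS addKn.
    by rewrite subnn.
  exists (vs1 ++ v' :: vs2); split.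
  - by apply: (template_insert hub_h head_v' v_ne v'_ne perm_w perm_es); rewrite -Evs.
  - by rewrite [in RHS]Evs !size_cat.
  - by move=> j; rewrite nthE; case: eqP => [->|]; rewrite ?muln0 ?addn0 // size_v'.
  move=> j; rewrite /touched !nthE; case: (j =P i) => [_ _|_]; first by rewrite has_v'.
  case: (j.+1 =P i) => [->|] //; rewrite -/v.
  by case: (v) (v') v_ne v'_ne head_v' => [|? ?] [|? ?] //= _ _ ->.
have perm_detour p h q : perm_eq (p ++ h :: detour h n ++ h :: q)
    (h :: detour h n ++ p ++ h :: q).
  by rewrite -[h :: detour h n ++ h :: q]/((h :: detour h n) ++ _) perm_catCA.
have flattenE p h q : flatten (vs1 ++ (p ++ h :: q) :: vs2) =
    (flatten vs1 ++ p) ++ h :: q ++ flatten vs2.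
  by rewrite flatten_cat /= -!catA.
(* A hub inside the block takes the detour on the spot. *)
have [/hasP[h hv hub_h]|v_nohub] := boolP (has hub v).
  have [p [q Ev]] : exists p q, v = p ++ h :: q by case/splitPr: hv => p q; exists p, q.
  apply: (conclude h (p ++ h :: detour h n ++ h :: q)) => //.
  - by rewrite Ev; case: (p).
  - by case: (p).
  - by rewrite Ev !size_cat /= addnS; lia.
  - by rewrite has_cat /= hub_h orbT.
  - rewrite Ev !flattenE; exact: perm_detour.
  rewrite Ev !flattenE; exact: tedges_detour.
(* The hub [h] opens the next block: [h] and its detour are appended to this block, and the next one
   still starts with [h], so the marks stay in place. *)
move: touched_i; rewrite /touched -/v (negPf v_nohub) /=.
have -> : nth [::] vs i.+1 = head [::] vs2 by rewrite /vs2 -nth0 nth_drop addn0.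
have flatten0 u : flatten (vs1 ++ u :: vs2) = (flatten vs1 ++ u) ++ flatten vs2.
  by rewrite flatten_cat /= catA.
case: (vs2) conclude flatten0 => [|[|h q] vs3] //= conclude flatten0 hub_h.
apply: (conclude h (v ++ h :: detour h n)) => //.
- by case: (v) v_ne.
- by case: (v).
- by rewrite size_cat.
- by rewrite has_cat /= hub_h orbT.
- rewrite !flatten0 catA -[(_ ++ h :: detour h n) ++ _]catA; exact: perm_detour.
rewrite !flatten0 catA -[(_ ++ h :: detour h n) ++ _]catA; exact: tedges_detour.
Qed.

(** * A finite complete set of splices *)

(* Splices are written as words: v, .., z for x_0, .., x_4, a and b for the
   hubs, u for a fresh vertex; capitals are the marked positions. *)
Definition letter (c : ascii) : bool * nat :=
  match c with
  | "v" => (false, 0) | "V" => (true, 0)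
  | "w" => (false, 1) | "W" => (true, 1)
  | "x" => (false, 2) | "X" => (true, 2)
  | "y" => (false, 3) | "Y" => (true, 3)
  | "z" => (false, 4)
  | "a" => (false, 5) | "A" => (true, 5)
  | "b" => (false, 6) | "B" => (true, 6)
  | _ => (false, 7)
  end%char.

(** The first block of the result is still open to the left. A capital closes it and opens an empty
    one; [decode] drops the empty block left before the initial capital. The counter [n] numbers the
    fresh vertices. *)
Fixpoint decode_from n (s : string) : seq (seq nat) :=
  if s is String c s' then
    let: (leg, a) := letter c in
    let: bs := decode_from (n + (a == 7)) s' in
    let: b := (if a == 7 then 7 + n else a) :: head [::] bs in
    if leg then [:: [::], b & behead bs] else b :: behead bs
  else [:: [::]].

Definition decode s := behead (decode_from 0 s).

Definition code_b vs : bitseq :=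
  [seq j \in [seq head 0 v | v <- vs] | j <- iota 0 4].
Definition code_T vs :=
  let: es := [seq e <- tedges (flatten vs) | hub_edge e] in
  [seq j <- iota 0 5 | has (fun e => (e.1 == j) || (e.2 == j)) es].
Definition code_n vs := count (leq 7) (flatten vs).

(** Decidable form of [template] for five blocks. A splice has as many edges as letters, four of
    them old, so the last equation says that all edges from a hub to the other hub, to [T] or to a
    fresh letter are used. *)
Definition valid_code vs :=
  let b := code_b vs in let T := code_T vs in let n := code_n vs in
  let es := tedges (flatten vs) in
  let D := [:: 5, 6 & T ++ iota 7 n] in
  [&& [&& all (fun v => v != [::]) vs, head 0 (head [::] vs) == 0,
          size b == 4, count id b == 3, vs != [::] &
          all (gtn (7 + n)) (flatten vs)],
      uniq es, strict es,
      perm_eq [seq e <- es | ~~ hub_edge e] [:: (0, 1); (1, 2); (2, 3); (3, 4)],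
      all (fun e => (e.1 \in D) && (e.2 \in D)) [seq e <- es | hub_edge e],
      all (gtn 5) T, allrel (fun i j => (i <= j) ==> apart b i j) T T,
      perm_eq [seq head 0 v | v <- vs] [:: 5, 6 & mask b (iota 0 4)],
      size vs == 5 &
      2 * (size T + n) + 5 == sumn [seq size v | v <- vs]].

Lemma valid_codeP vs : valid_code vs ->
  [/\ template (code_b vs) (code_T vs) (code_n vs) vs, size vs = 5 &
      2 * (size (code_T vs) + code_n vs) + 5 = sumn [seq size v | v <- vs]].
Proof.
by case/and5P=> H1 H2 H3 H4 /and5P[H5 H6 H7 H8 /andP[/eqP H9 /eqP H10]].
Qed.

Local Open Scope string_scope.

(* Found by computer search. *)
Definition codes : seq string := [::
  "VAWBXabvwxy"; "VABYxbvwXay"; "VAWbvwxYBay"; "VAbvwxYBWay"; "VabvwXAWBxy";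
  "VABWaXbvwxy"; "VABWaubvwXy"; "VAWbvwxYaBy"; "VAbvwaYBwXy"; "VabvwXAYxBy";
  "VABWvbXawxy"; "VABWaubvwxY"; "VABuayxWvbY"; "VAbvwaXBwxY"; "VwxayXBYzbA";
  "VABXwbvWaxy"; "VAWvBXabwxy"; "VABvWaubwXy"; "VABvWXy"; "VABvWaXbwxy";
  "VABvWaubwxY"; "VABvWxY"; "VABvWxaYbxy"; "VABxYbvwXay"; "VAWbaXBvwxy";
  "VABuaWbvwxY"; "VABvwXY"; "VABvwXaWbxy"; "VABwxYbvWay"; "VAWbaYxwvBy";
  "VAWbvwXBaxy"; "VABvwxYaWby"; "VAWvbaYxwBy"; "VABuawXaubWvbxy";
  "VABuaxWvbxY"; "VAwXBWvbaxy"; "VAuBWabvwXy"; "VAxYabvwXBy"; "VAbvwaxWBXy";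
  "VwayxWbAXBy"; "VAwXBvWbaxy"; "VAuBWabvwxY"; "VAbWaxwvBxY"; "VAbvwaxWBxY";
  "VwxabYzBXyA"; "VAxYBvwXbay"; "VAuBWabxYaxwvby"; "VAuBXabvWxy";
  "VAbWaXBvwxy"; "VAbWxBvwaxY"; "VAbWayxwvBY"; "VAbuayxWvBY"; "VwxabXyAzYB";
  "VAbXaWvBwxy"; "VAbWaXwvBxy"; "VAbWaYxwvBy"; "VAbXwvBWaxy"; "VAbYaxWvBxy";
  "VAxYabXwvBy"; "VAbWauBvwxYauby"; "VAbWauBvwxY"; "VAbYxwvBWay";
  "VAxYabvWxBy"; "VAbWaubXauBvwxy"; "VAbXawvBwxY"; "VAbWaubYxwvBuay";
  "VAbvWBXawxy"; "VAbvWBuawxY"; "VAbvWayxwBY"; "VAbvwayxWBY"; "VwxabXyzAYB";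
  "VAbwXBvWaxy"; "VAbxYBvwXay"; "VAbvWBuawXaubxy"; "VAbvWBuawXy";
  "VAbvWaXBwxy"; "VAbvWaXwBxy"; "VAbvWaYxwBy"; "VAbvWaYbwxBuaxy";
  "VAbvWxBuaxY"; "VAbvWxaYBxy"; "VAbvWxaYxBy"; "VAbvWauBuaXbwxy";
  "VAbvWauBwxY"; "VAbvWauBwxaYbxy"; "VAwxYabvWBy"; "VAbvWaubXwBuaxy";
  "VAbvWaxwBxY"; "VAbvWaubXauBwxy"; "VAbvWaubYaxwBxy"; "VAbvwXBWaxy";
  "VAbwxYBvWay"; "VAbuaWBuaXbvwxy"; "VAbuaWBvwXy"; "VAbuaWBvwxYauby";
  "VAbuaWBvwxY"; "VAbvwXaWBxy"; "VAbvwXaYxBy"; "VAbuaWbXauBvwxy";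
  "VAbuaWvBwxY"; "VAbuaWbYxwvBuay"; "VAbuaWbxYBvwxay"; "VAubvWxaBXy";
  "VAbuaWxaYxBvwby"; "VAbuaXwvBxY"; "VAbuaWvbXauBwxy"; "VAbuaWxaYbvwBxy";
  "VAbuaWbuaXBvwxy"; "VAbvwXayxBY"; "VAbuaXbuaWvBwxy"; "VAbuaWbuaXwvBxy";
  "VAbuaWbuaYxwvBy"; "VaBWAXbvwxy"; "VaWBYxwvbAy"; "VwABWXy"; "VaBYAxWvbxy";
  "VaBWAubvwxY"; "VwABWxY"; "VaXBWvbAwxy"; "VaWBXwvbAxy"; "VaXBvWAbwxy";
  "VaBWxAwvbxY"; "VwABwXY"; "VaXBvWbAwxy"; "VaYBvWxbAxy"; "VwAXbWxyaBy";
  "VaBWvbXAwxy"; "VaBWvbXwAxy"; "VaBWvbYxwAy"; "VaBWxaYbvwAubxy";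
  "VaBWxyAwvbY"; "VaBXwbvWAxy"; "VaBXwvbYxAy"; "VaBWvbuAubXawxy";
  "VaBWvbuAwxY"; "VaBWxbuAwvbYaxy"; "VaBvWAXbwxy"; "VaBuAWbvwxY";
  "VaBvWbyxwAY"; "VaBvwbyxWAY"; "VwxazyXbAYB"; "VaBxYAxWvby"; "VaWbAXwvBxy";
  "VaWbAYxwvBy"; "VaBvWbXAwxy"; "VaBvWbXwAxy"; "VaBvWbYxwAy";
  "VaBuAwXaubWvbxy"; "VaBuAxWvbxY"; "VaBvWxbYAxy"; "VaBvWxbYxAy";
  "VaBuAubWvbXawxy"; "VaBuAyxWvbY"; "VaBuAubXwbvWaxy"; "VaBxYbvwXAy";
  "VaBuAubvWaXbwxy"; "VaBvWbxwAxY"; "VaBuAubvWxaYbxy"; "VaBuAubxYbvwXay";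
  "VaBvwXAWbxy"; "VaWvbAXwBxy"; "VaWvbAYxwBy"; "VaBvwAXbuaYbwxy";
  "VaBvwAXbwxY"; "VaBvwXbWAxy"; "VaBvwXbYxAy"; "VaBuaXwAubWvbxy";
  "VaBvwAxWbxY"; "VaBuaXbWvbuAwxy"; "VaBwxYbvWAy"; "VaBuaYbuAxWvbxy";
  "VaBvwAyxWbY"; "VaBuaXbvWbuAwxy"; "VaBuaWvbXwbuAxy"; "VaBuaWbvwXAubxy";
  "VaBvwXbyxAY"; "VaBuaYbvwAxWbxy"; "VaBuaWbvwXbuAxy"; "VaBuaWvbxYbwxAy";
  "VaBvwxYAWby"; "VaXwvbAYxBy"; "VaBuawXAubWvbxy"; "VaBvwbXAwxY";
  "VaBuawXAubvWbxy"; "VaBvwxYbWAy"; "VaBvwaYbWxAubxy"; "VaBvwbXwAxY";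
  "VaBvwaYxAubWxby"; "VaBuawXbWvbuAxy"; "VaBuaxWbxYAwvby"; "VaXwvbAyxBY";
  "VaBvwaYbuAxWbxy"; "VaBuawXbvWbuAxy"; "VaBuaxYbvWbxwAy"; "VaBuaxWbvwAYbxy";
  "VaBvwaYxbuAxWby"; "VaBuaxYbvwXbuAy"; "VaBuawXaubWvbuAubxy";
  "VaBuaxWbvwAubxY"; "VabWAXBvwxy"; "VauBAWbvwxY"; "VwxABXY"; "VabXAWvBwxy";
  "VabWAXwvBxy"; "VabWAYxwvBy"; "VwaBWxAYbxy"; "VabYAxWvBxy"; "VaxYAbXwvBy";
  "VwxAYbXyzaB"; "VawXAbvWBxy"; "VaxYAbvWxBy"; "VabWAubXauBvwxy";
  "VabXAwvBwxY"; "VabWAubYxwvBuay"; "VaxYAbvwXBy"; "VwxAYzabXyB";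
  "VabWAxwvBuaYbxy"; "VabYAubvWaxwBxy"; "VabWvBXAwxy"; "VabWvBXwAxy";
  "VabWvBYxwAy"; "VabWaYBvwxAubxy"; "VauBvWAbwxY"; "VabXwBvWAxy";
  "VabYxBvWxAy"; "VwxAyXbYzaB"; "VabWaYxBvwxAuby"; "VabYxBvwXAy";
  "VwxAzYabXyB"; "VabWxAwvBuaYbxy"; "VabWaYbuAxwvBxy"; "VwxAbXyazYB";
  "VabWaYxwvBuAuby"; "VabWxAwvbYauBxy"; "VabWaYxbuAxwvBy"; "VabXwvBWAxy";
  "VabXwvBYxAy"; "VabWxaYBvwAubxy"; "VauBvwXAbxY"; "VabXauBWvbuAwxy";
  "VabYxwBvWAy"; "VwxAzyXbYaB"; "VabWxaYxBvwAuby"; "VabYauBvWbxwAxy";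
  "VwxAzyXbaYB"; "VabWvbXauBuAwxy"; "VabWauBvwXbuAxy"; "VabXauBwxYbvwAy";
  "VabWauBvwxAYbxy"; "VabWxaYbvwAuBxy"; "VabWauBvwxYbuAy"; "VwxAbyXbuaYzauB";
  "VabYxwvBWAy"; "VabWaubXAuBvwxy"; "VawXbvwBAxY"; "VabXaubYAwvBwxy";
  "VabWaubYAxwvBxy"; "VabWxauBxYAwvby"; "VayXwvbAuBY"; "VabXaubWvBuAwxy";
  "VabWvbuAwXauBxy"; "VabWaubYxBvwxAy"; "VabWxauBvwAYbxy"; "VabWaubXwvBuAxy";
  "VabWvbuAwxYauBy"; "VwxAubyXbaYzauB"; "VabWvbuAwxaYBxy"; "VabWaubYxwvBuAy";
  "VwxAubyXbazYauB"; "VabWaubYxbuAxwvBuay"; "VabvWAXBwxy"; "VabvWAXwBxy";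
  "VabvWAYxwBy"; "VwxaYBXyzbA"; "VabwXBvWAxy"; "VabxYAxWvBy"; "VwxyAXbYzaB";
  "VabuAWbYxwvBuay"; "VabxYBvwXAy"; "VwxaBYzbXyA"; "VabuAWvbXauBwxy";
  "VabuAWxaYbvwBxy"; "VwxaBXybzYA"; "VabuAXbuaWvBwxy"; "VabuAWbuaXwvBxy";
  "VabuAWbuaYxwvBy"; "VabvWxAYBxy"; "VabvWxAYxBy"; "VwxaYzBXybA";
  "VabuAuBXwbvWaxy"; "VawxYbWvBAy"; "VwxaBzYbXyA"; "VabuAuBvWxaYbxy";
  "VabuAuBxYbvwXay"; "VwxaByXbzYA"; "VabuAuBvwXaWbxy"; "VabuAuBwxYbvWay";
  "VabuAxYawXbvwBy"; "VabuAwXbvwBYaxy"; "VabuAuBvwxYaWby"; "VabuAxYaubXwvBy";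
  "VwxaByXbuaYzbuA"; "VawxYbvWBAy"; "VabuAwxYBvWbuay"; "VaubXwvBAxY";
  "VabuAwxBWvbYaxy"; "VabuAwxYBvwbXay"; "VwxaBzyXbYA"; "VabuAubXaWvBwxy";
  "VabuAubWaXwvBxy"; "VabuAubWaYxwvBy"; "VabuAubXwvBWaxy"; "VabuAubYaxWvBxy";
  "VabvWauBwxYbuAy"; "VwxaBuaYzbXybuA"; "VabuAubYxwvBWay"; "VabuAwxYaubWvBy";
  "VwxaBuaYbzyXbuA"; "VabuAubWaubYxwvBuay"; "VwxaYbzyXBA"; "VabuAubwXBvWaxy";
  "VabuAubxYBvwXay"; "VabvWaxwBYxbuAy"; "VabuAubvWaXBwxy"; "VabuAubvWaXwBxy";
  "VabuAubvWaYxwBy"; "VwxaBuayXbYzbuA"; "VabuAubvWxaYBxy"; "VabuAubvWxaYxBy";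
  "VwxaBuayXbzYbuA"; "VabuAubvWauBwxaYbxy"; "VabuAwxaYxbvWBy";
  "VwxaYbzyXbauBuA"; "VabuAubvWaubXauBwxy"; "VabuAubvWaubYaxwBxy"].

Local Close Scope string_scope.

Lemma codes_valid : all valid_code (map decode codes).
Proof. by vm_compute. Qed.

Fixpoint words (T : Type) n (s : seq T) : seq (seq T) :=
  if n is n'.+1 then [seq a :: w | a <- s, w <- words n' s] else [:: [::]].

Lemma mem_words (T : eqType) n (s w : seq T) :
  size w = n -> all (mem s) w -> w \in words n s.
Proof.
elim: n w => [|n IH] [|a w] //= [size_w] /andP[a_in w_in].
by apply/allpairsP; exists (a, w); split=> //; exact: IH.
Qed.

(* [r] lists the five gaps reduced modulo 4 to 1, .., 4, and [t] the gaps that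
   exceed 4; gaps covered here stay covered when those in [t] grow by 4. *)
Definition spans (ct : seq nat * bitseq) r (t : bitseq) :=
  all (fun i => let c := nth 0 ct.1 i in let g := nth 0 r i + 4 * nth false t i in
    [&& c %% 4 == g %% 4, c <= g & nth false ct.2 i || (c == g) && ~~ nth false t i])
    (iota 0 5).

Definition code_shape vs := ([seq size v | v <- vs], [seq touched vs i | i <- iota 0 5]).

(** The five gaps sum to 4h + 3 with h >= 4. This gives the residue 3, and a sum of at least 19 when
    no gap exceeds 4. Filtering by residues first keeps the computation short. *)
Definition covered :=
  let sh := map code_shape (map decode codes) in
  all (fun r => (sumn r %% 4 == 3) ==>
    let sh' := [seq ct <- sh | all2 (fun c r => c %% 4 == r %% 4) ct.1 r] in
    all (fun t => (19 <= sumn r) || has id t ==> has (fun ct => spans ct r t) sh')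
      (words 5 [:: true; false])) (words 5 [:: 1; 2; 3; 4]).

Lemma codes_cover : covered.
Proof. by vm_compute. Qed.

Lemma template_extend_many b T n vs (e : nat -> nat) :
    template b T n vs -> (forall i, 0 < e i -> i < size vs /\ touched vs i) ->
  exists vs', [/\ template b T (n + 2 * \sum_(i < size vs) e i) vs', size vs' = size vs &
    forall j, size (nth [::] vs' j) = size (nth [::] vs j) + 4 * e j].
Proof.
move=> tmpl He; have [N EN] := ubnP (\sum_(i < size vs) e i).
elim: N n vs e EN tmpl He => // N IH n vs e; rewrite ltnS => leN tmpl He.
have [/existsP[i e_i]|] := boolP [exists i : 'I_(size vs), 0 < e i]; last first.
  rewrite negb_exists => /forallP e0.
  have e0' j : e j = 0.
    apply/eqP; rewrite eqn0Ngt; apply/negP=> e_j; have [lt_j _] := He _ e_j.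
    by have := e0 (Ordinal lt_j); rewrite e_j.
  exists vs; split=> // [|j]; last by rewrite e0' addn0.
  by rewrite big1 ?addn0.
have [_ touched_i] := He _ e_i.
have [vs1 [tmpl1 size1 nth1 touched1]] := template_extend tmpl (ltn_ord i) touched_i.
pose e1 j := e j - (j == i).
have sum_e : \sum_(j < size vs) e j = (\sum_(j < size vs) e1 j).+1.
  rewrite (bigD1 i) //= [in RHS](bigD1 i) //= /e1 eqxx -addSn subn1 prednK //.
  congr (_ + _); apply: eq_bigr => j ne_ji; rewrite -val_eqE in ne_ji.
  by rewrite (negPf ne_ji) subn0.
have lt_e1 : \sum_(j < size vs1) e1 j < N by rewrite size1 -ltnS -sum_e ltnS.
have He1 j : 0 < e1 j -> j < size vs1 /\ touched vs1 j.
  move=> e1_j; have /He[lt_j /touched1] : 0 < e j.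
    by apply: leq_trans e1_j (leq_subr _ _).
  by rewrite size1.
have [vs2 [tmpl2 size2 nth2]] := IH n.+2 vs1 e1 lt_e1 tmpl1 He1.
exists vs2; split; rewrite ?size2 //.
  by rewrite sum_e -size1 mulnS addnA addn2.
move=> j; rewrite nth2 nth1 -addnA -mulnDr; congr (_ + 4 * _).
by rewrite /e1; case: eqP => [->|_]; rewrite ?subn0 // addnC subnK.
Qed.

(** A tabulated splice fits the gaps up to multiples of 4, and detours make up the differences. Each
    detour adds 4 letters and 2 vertices, so the edge count of [valid_code] persists and yields
    [size T + n]. *)
Lemma template_exists h gs : 3 < h -> size gs = 5 -> all (leq 1) gs ->
    sumn gs = 4 * h + 3 ->
  exists b T n vs, [/\ template b T n vs, size T + n = 2 * h - 1 &
    [seq size v | v <- vs] = gs].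
Proof.
move=> h_gt3 size_gs gs_gt0 sum_gs.
pose r := [seq (g.-1 %% 4).+1 | g <- gs]; pose t := [seq 4 < g | g <- gs].
have nth_r i : i < 5 -> nth 0 r i = ((nth 0 gs i).-1 %% 4).+1.
  by move=> lt_i; rewrite (nth_map 0) ?size_gs.
have nth_t i : i < 5 -> nth false t i = (4 < nth 0 gs i).
  by move=> lt_i; rewrite (nth_map 0) ?size_gs.
have gs_gt i : i < 5 -> 0 < nth 0 gs i.
  by move=> lt_i; apply: (allP gs_gt0); rewrite mem_nth ?size_gs.
have r_in : r \in words 5 [:: 1; 2; 3; 4].
  apply: mem_words; rewrite ?size_map //; apply/allP=> _ /mapP[g _ ->].
  by have := ltn_pmod g.-1 (isT : 0 < 4); case: (_ %% 4) => [|[|[|[|]]]].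
have t_in : t \in words 5 [:: true; false].
  by apply: mem_words; rewrite ?size_map //; apply/allP=> -[].
have sum5 s : size s = 5 -> sumn s =
    nth 0 s 0 + nth 0 s 1 + nth 0 s 2 + nth 0 s 3 + nth 0 s 4.
  by case: s => [|a0 [|a1 [|a2 [|a3 [|a4 []]]]]] //= _; rewrite addn0 !addnA.
have r_mod : sumn r %% 4 == 3.
  apply/eqP; move: sum_gs; rewrite !sum5 ?size_map // !nth_r //.
  move: (gs_gt 0 isT) (gs_gt 1 isT) (gs_gt 2 isT) (gs_gt 3 isT) (gs_gt 4 isT).
  by clear; move: (nth 0 gs 0) (nth 0 gs 1) (nth 0 gs 2) (nth 0 gs 3) (nth 0 gs 4); lia.
have big_rt : (19 <= sumn r) || has id t.
  have [|t0] := boolP (has id t); first by rewrite orbT.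
  rewrite orbF; suff -> : r = gs by rewrite sum_gs; move: h_gt3; clear; lia.
  apply: (@eq_from_nth _ 0); rewrite size_map // size_gs => i lt_i.
  rewrite nth_r //; move: (gs_gt _ lt_i).
  have : nth 0 gs i <= 4.
    rewrite leqNgt -nth_t //; apply: contra t0 => Hi; apply/(has_nthP false).
    by exists i; rewrite ?size_map ?size_gs.
  by case: (nth 0 gs i) => [|[|[|[|[|]]]]].
have /hasP[[cs ts]] : has (fun ct => spans ct r t)
    [seq ct <- map code_shape (map decode codes) |
       all2 (fun c r => c %% 4 == r %% 4) ct.1 r].
  by have /allP/(_ _ r_in)/implyP/(_ r_mod)/allP/(_ _ t_in)/implyP/(_ big_rt) := codes_cover.
rewrite mem_filter => /andP[_ /mapP[vs vs_in]].
rewrite /code_shape => -[-> ->] /allP spans_rt.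
move: (allP codes_valid _ vs_in) spans_rt => /valid_codeP.
move: (code_b vs) (code_T vs) (code_n vs) => b T n [tmpl size_vs sizes] spans_rt.
(* [e i] is the number of detours still to be put into block [i]. *)
pose c i := size (nth [::] vs i); pose e i := (nth 0 gs i - c i) %/ 4.
have spanE i : i < 5 -> nth 0 gs i = c i + 4 * e i /\ (0 < e i -> touched vs i).
  move=> lt_i; have := spans_rt i; rewrite mem_iota lt_i => /(_ isT).
  lazy zeta beta delta [fst snd] iota.
  have -> : nth false [seq touched vs i | i <- iota 0 5] i = touched vs i.
    by rewrite (nth_map 0) ?size_iota // nth_iota.
  rewrite (nth_map [::]) ?size_vs //.
  rewrite nth_r // nth_t // -/(c i) /e; move: (gs_gt i lt_i).
  by case: (touched vs i); move: (nth 0 gs i) (c i); clear; move=> g d /=; lia.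
have e_out i : 5 <= i -> e i = 0.
  by move=> le_i; rewrite /e nth_default ?size_gs // sub0n div0n.
have He i : 0 < e i -> i < size vs /\ touched vs i.
  move=> e_i; have lt_i : i < 5 by rewrite ltnNge; apply/negP=> /e_out E0; rewrite E0 in e_i.
  by rewrite size_vs; split=> //; apply: (spanE i lt_i).2.
have [vs' [tmpl' size' nth']] := template_extend_many tmpl He.
exists b, T, (n + 2 * \sum_(i < size vs) e i), vs'; split=> //; last first.
  apply: (@eq_from_nth _ 0); rewrite size_map size' size_vs ?size_gs // => i lt_i.
  by rewrite (nth_map [::]) ?size' ?size_vs // nth' -/(c i) (spanE i lt_i).1.
move: sizes sum_gs; rewrite !sum5 ?size_map // !(nth_map [::]) ?size_vs //.
rewrite (spanE 0 isT).1 (spanE 1 isT).1 (spanE 2 isT).1 (spanE 3 isT).1 (spanE 4 isT).1.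
rewrite !big_ord_recl big_ord0 /= /bump /= !add1n addn0 -!/(c _).
move: h_gt3; clear; lia.
Qed.

(** * Eulerian circuits with prescribed distinct vertices *)

Definition hosts k (m : bitseq) := exists2 x, circuit k x & uniq (mask m x).

Lemma cedges_rot n x : cedges (rot n x) = rot n (cedges x).
Proof.
have [le_xn|lt_nx] := leqP (size x) n.
  by rewrite !rot_oversize // size_pairmap.
rewrite -{2}(cat_take_drop n x) /rot /cedges.
have: drop n x != [::] by rewrite -size_eq0 size_drop subn_eq0 -ltnNge.
move: (take n x) (drop n x) (size_takel (ltnW lt_nx)) => p q <- q_ne.
rewrite !last_cat !pairmap_cat drop_size_cat ?size_pairmap //.
rewrite take_size_cat ?size_pairmap //.
by case: q q_ne.
Qed.

Lemma circuit_rot k n x : circuit k (rot n x) = circuit k x.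
Proof.
rewrite /circuit /strict cedges_rot size_rot rot_uniq.
by rewrite !(perm_all _ (permEl (perm_rot _ _))).
Qed.

Lemma hosts_rot k n m : size m = 'C(k, 2) -> hosts k (rot n m) -> hosts k m.
Proof.
move=> size_m [x x_circ x_uniq]; exists (rotr n x).
  by rewrite -(circuit_rot k n) rotrK.
have size_x : size (rotr n x) = size m.
  by rewrite size_rotr size_m; case/and4P: x_circ => /eqP.
by rewrite -(rotrK n x) mask_rot // rot_uniq in x_uniq.
Qed.

Lemma bin2_odd h : 'C((2 * h).+1, 2) = h * (2 * h).+1.
Proof. by rewrite bin2 /= mulnC -mulnA mul2n doubleK. Qed.

(** The mean number of marks in a window of 4h + 3 positions is 4 + 3/h, which lies in (4, 5] for h
    >= 3. *)
Lemma odd_window h m : 2 < h -> size m = 'C((2 * h).+1, 2) ->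
    count id m = (2 * h).+1 ->
  exists n u v, [/\ rot n m = u ++ v, size u = 4 * h + 3, nth false u 0,
    count id u = 5 & count id v + 4 = 2 * h].
Proof.
move=> h_gt2; rewrite bin2_odd => size_m count_m.
have [|||n _ /andP[m0 /eqP cm]] := @exists_window 4 (4 * h + 3) m.
- by rewrite size_m; nia.
- by rewrite size_m count_m; nia.
- by rewrite size_m count_m; nia.
exists n, (take (4 * h + 3) (rot n m)), (drop (4 * h + 3) (rot n m)).
rewrite cat_take_drop size_takel ?size_rot ?size_m; last by nia.
rewrite nth_take ?addn3 // -addn3; split=> //.
have := count_cat id (take (4 * h + 3) (rot n m)) (drop (4 * h + 3) (rot n m)).
rewrite cat_take_drop cm.
have -> : count id (rot n m) = (2 * h).+1.
  by rewrite -count_m; apply/permP; rewrite perm_rot.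
lia.
Qed.

Lemma transversal_step h : 3 < h ->
    (forall m, size m = 'C(2 * h - 1, 2) -> count id m = 2 * h - 1 ->
       hosts (2 * h - 1) m) ->
  forall m, size m = 'C((2 * h).+1, 2) -> count id m = (2 * h).+1 ->
    hosts (2 * h).+1 m.
Proof.
move=> h_gt3 IH m size_m count_m.
have [n [u [v [Em size_u u0 count_u count_v]]]] :=
  odd_window (ltnW h_gt3) size_m count_m.
apply: (hosts_rot (n := n)) => //; rewrite Em.
have [ds size_ds Eu] := blocks_exists u0.
have [|||b [T [n' [vs [tmpl size_T size_vs]]]]] :=
    @template_exists h [seq d.+1 | d <- ds] h_gt3.
- by rewrite size_map size_ds.
- by rewrite all_map; apply/allP.
- rewrite -size_u Eu /blocks size_flatten /shape -map_comp.
  by congr sumn; apply: eq_map => d /=; rewrite size_nseq.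
have Eds : [seq (size v).-1 | v <- vs] = ds.
  by rewrite (map_comp predn) size_vs -map_comp map_id.
have /and5P[_ _ /eqP size_b /eqP count_b _] : _ := let: And5 H _ _ _ _ := tmpl in H.
have size_bin : 'C(2 * h - 1, 2) + (4 * h - 1) = 'C((2 * h).+1, 2).
  have [h' Eh] : exists h', h = h'.+1 by exists h.-1; lia.
  have -> : 2 * h - 1 = (2 * h').+1 by lia.
  by rewrite !bin2_odd Eh; nia.
have size_v : size (rot n m) = size u + size v by rewrite Em size_cat.
rewrite size_rot in size_v.
(* The window with five marks shrinks to four positions with three marks: 4h - 1 positions and two
   marks fewer, as K_(2h-1) requires. *)
have [||x x_circ x_uniq] := IH (b ++ v).
- by rewrite size_cat size_b; lia.
- by rewrite count_cat count_b; lia.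
have size_x : size x = 'C(2 * h - 1, 2) by case/and4P: x_circ => /eqP.
have x_gt4 : 4 < size x.
  have : h * (2 * h).+1 = 'C((2 * h).+1, 2) by rewrite bin2_odd.
  by rewrite size_x; nia.
have [||y [size_y y_lt y_strict y_uniq y_mask]] :=
    @template_expand (2 * h - 1) b T n' vs x v tmpl _ x_circ x_gt4 _ x_uniq.
- by rewrite size_T.
- by rewrite size_cat size_b size_x; lia.
exists y; last by rewrite Eu -Eds.
have Ek : (2 * h - 1).+2 = (2 * h).+1 by lia.
rewrite Ek in y_lt; apply/and4P; split=> //.
rewrite -(eqn_add2r 4) size_y size_flatten /shape size_vs.
have -> : sumn [seq d.+1 | d <- ds] = 4 * h + 3.
  rewrite -size_u Eu /blocks size_flatten /shape -map_comp.
  by congr sumn; apply: eq_map => d /=; rewrite size_nseq.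
by apply/eqP; lia.
Qed.

(** * Base circuits for k = 7 and k = 5 *)

Fixpoint masks n c : seq bitseq :=
  if n is n'.+1 then
    (if c is c'.+1 then map (cons true) (masks n' c') else [::])
      ++ map (cons false) (masks n' c)
  else if c is 0 then [:: [::]] else [::].

Lemma mem_masks m : m \in masks (size m) (count id m).
Proof.
elim: m => //= b m IH; rewrite mem_cat; apply/orP.
by case: b => /=; [left|right]; apply: map_f.
Qed.

(* Found by computer search. *)
Definition circuits7 := [::
  [:: 0; 3; 5; 6; 4; 3; 1; 0; 5; 2; 4; 5; 1; 2; 3; 6; 0; 2; 6; 1; 4];
  [:: 0; 6; 4; 0; 1; 2; 4; 3; 0; 5; 2; 6; 3; 5; 4; 1; 5; 6; 1; 3; 2];
  [:: 0; 3; 6; 1; 5; 2; 1; 3; 4; 2; 6; 0; 5; 3; 2; 0; 4; 6; 5; 4; 1];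
  [:: 0; 5; 2; 3; 0; 4; 2; 6; 5; 3; 4; 5; 1; 0; 6; 4; 1; 3; 6; 1; 2];
  [:: 0; 4; 3; 6; 0; 2; 6; 4; 1; 3; 0; 5; 3; 2; 1; 6; 5; 4; 2; 5; 1];
  [:: 0; 4; 2; 3; 6; 1; 0; 2; 6; 4; 1; 5; 4; 3; 0; 5; 2; 1; 3; 5; 6];
  [:: 0; 5; 6; 0; 2; 1; 4; 5; 2; 3; 6; 1; 5; 3; 1; 0; 4; 6; 2; 4; 3];
  [:: 0; 6; 3; 0; 4; 3; 5; 0; 2; 1; 3; 2; 5; 6; 4; 2; 6; 1; 4; 5; 1];
  [:: 0; 3; 6; 2; 5; 3; 2; 0; 5; 4; 0; 6; 1; 2; 4; 6; 5; 1; 3; 4; 1];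
  [:: 0; 1; 4; 5; 3; 0; 2; 1; 5; 2; 4; 3; 2; 6; 1; 3; 6; 0; 4; 6; 5];
  [:: 0; 6; 1; 4; 5; 3; 2; 1; 0; 5; 2; 4; 0; 2; 6; 3; 4; 6; 5; 1; 3];
  [:: 0; 2; 4; 6; 5; 4; 0; 5; 1; 6; 2; 5; 3; 0; 6; 3; 2; 1; 3; 4; 1];
  [:: 0; 4; 2; 5; 1; 4; 6; 2; 0; 5; 4; 3; 0; 1; 2; 3; 6; 1; 3; 5; 6];
  [:: 0; 2; 3; 4; 1; 2; 4; 5; 6; 4; 0; 1; 5; 3; 0; 6; 1; 3; 6; 2; 5];
  [:: 0; 6; 2; 5; 6; 4; 0; 3; 2; 4; 1; 3; 5; 0; 1; 6; 3; 4; 5; 1; 2];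
  [:: 0; 2; 5; 6; 4; 3; 1; 5; 3; 6; 0; 1; 6; 2; 4; 5; 0; 4; 1; 2; 3];
  [:: 0; 3; 1; 5; 6; 2; 3; 6; 0; 2; 4; 1; 6; 4; 0; 1; 2; 5; 4; 3; 5]].

Definition rotations (xs : seq (seq nat)) :=
  [seq rot n x | x <- xs, n <- iota 0 (size x)].

(** Markings are split as [u ++ v] so that circuits repeating a vertex already on [u] are discarded
    once for all [v]. *)
Definition transversals xs us vs :=
  all (fun u : bitseq =>
    let xs' := [seq x <- xs | uniq (mask u x)] in
    all (fun v => has (fun x : seq nat => uniq (mask (u ++ v) x)) xs') vs) us.

Lemma transversalsP xs us vs u v : transversals xs us vs -> u \in us -> v \in vs ->
  exists2 x, x \in xs & uniq (mask (u ++ v) x).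
Proof.
move=> /allP usP /usP /allP vsP /vsP /hasP[x].
by rewrite mem_filter => /andP[_ x_in]; exists x.
Qed.

(** For h = 3 the window has 15 positions, the first marked and five marked in all; the other 6
    positions carry two marks. *)
Lemma circuits7_transversals : transversals (rotations circuits7)
  (map (cons true) (masks 14 4)) (masks 6 2).
Proof. by vm_compute. Qed.

Lemma rotations_circuit k xs x : all (circuit k) xs -> x \in rotations xs -> circuit k x.
Proof.
by move=> /allP xsP /allpairsPdep[y [n [/xsP y_circ _ ->]]]; rewrite circuit_rot.
Qed.

Lemma transversal7 m : size m = 'C(7, 2) -> count id m = 7 -> hosts 7 m.
Proof.
move=> size_m count_m.
have [n [u [v [Em size_u u0 count_u count_v]]]] := @odd_window 3 m isT size_m count_m.
apply: (hosts_rot (n := n)) => //; rewrite Em.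
have size_v : size v = 6.
  have : size (rot n m) = 15 + size v by rewrite Em size_cat size_u.
  by rewrite size_rot size_m => /(congr1 (subn^~ 15)); rewrite addKn => <-.
have v_in : v \in masks 6 2.
  by rewrite -size_v -[2](addnK 4) -{1}[2 + 4]count_v addnK mem_masks.
case: u size_u u0 count_u {Em} => [|[] u] //= [size_u] _ [count_u].
have size_u' : size u = 14 := size_u; have count_u' : count id u = 4 := count_u.
have u_in := mem_masks u; rewrite size_u' count_u' in u_in.
have [x x_in x_uniq] := transversalsP circuits7_transversals (map_f _ u_in) v_in.
exists x => //; by apply: rotations_circuit x_in.
Qed.

Definition circuits5 := [:: [:: 0; 1; 2; 0; 3; 1; 4; 2; 3; 4];
  [:: 0; 1; 2; 0; 3; 1; 4; 3; 2; 4]; [:: 0; 1; 2; 0; 3; 2; 4; 3; 1; 4]].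

Definition hosts5 m := has (fun x => uniq (mask m x)) (rotations circuits5).

Lemma hosts5P m : hosts5 m -> hosts 5 m.
Proof. by case/hasP=> x x_in x_uniq; exists x => //; apply: rotations_circuit x_in. Qed.

Lemma transversal_odd h m : 2 < h -> size m = 'C((2 * h).+1, 2) ->
  count id m = (2 * h).+1 -> hosts (2 * h).+1 m.
Proof.
elim: h m => // h IH m; rewrite ltnS leq_eqVlt => /orP[/eqP<-|h_gt2].
  exact: transversal7.
apply: transversal_step => // m'.
have -> : 2 * h.+1 - 1 = (2 * h).+1 by lia.
by move=> *; apply: IH.
Qed.

(** * From circuits to caterpillars *)

Definition walk s := pairmap edge (head 0 s) (behead s).

(* A trail with loops, such that the loops at the positions marked in [b] are
   left unused. *)
Definition loopy k (b : bitseq) := exists s,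
  [/\ size s = size b, all (gtn k) s &
      uniq (walk s ++ [seq edge v v | v <- mask b s])].

(** Repeating the first vertex at the end opens the circuit into a trail; this last position carries
    no mark. The circuit has no loops, so those at the distinct marked vertices are free. *)
Lemma hosts_loopy k m : 0 < size m -> size m = 'C(k, 2) -> hosts k m ->
  loopy k (rcons m false).
Proof.
move=> m_gt0 size_m [x /and4P[/eqP size_x x_lt x_strict x_uniq] m_uniq].
case: x size_x x_lt x_strict x_uniq m_uniq => [|u x] size_x x_lt x_strict x_uniq m_uniq.
  by rewrite size_m -size_x in m_gt0.
exists (rcons (u :: x) u); split.
- by rewrite !size_rcons size_x size_m.
- by rewrite all_rcons x_lt andbT; case/andP: x_lt.
have walkE : perm_eq (walk (rcons (u :: x) u)) (cedges (u :: x)).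
  rewrite /walk /cedges /= -cats1 pairmap_cat /= -[X in perm_eq _ X]cat1s.
  by rewrite perm_catC.
rewrite mask_rcons ?size_m // cats0 cat_uniq (perm_uniq walkE) x_uniq /=.
rewrite map_inj_uniq ?m_uniq ?andbT => [|v w /edge_inj[] []//].
apply/hasPn=> _ /mapP[v _ ->]; rewrite (perm_mem walkE).
by apply/negP=> /(allP x_strict); rewrite /edge /= minnn maxnn ltnn.
Qed.

(** The trail traverses the loop reserved at the marked position, so that one marked visit becomes
    two unmarked ones. *)
Lemma loopy_split k b1 b2 : loopy k (b1 ++ true :: b2) ->
  loopy k (b1 ++ [:: false, false & b2]).
Proof.
case=> s; rewrite size_cat /= => -[size_s s_lt s_uniq].
have [s1 [v [s2 [Es size_s1]]]] : exists s1 v s2, s = s1 ++ v :: s2 /\ size s1 = size b1.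
  exists (take (size b1) s), (nth 0 s (size b1)), (drop (size b1).+1 s).
  rewrite -drop_nth ?cat_take_drop ?size_takel ?size_s ?leq_addr //.
  by rewrite addnS ltnS leq_addr.
move: size_s s_lt s_uniq; rewrite {s}Es => size_s s_lt s_uniq.
exists (s1 ++ [:: v, v & s2]); split.
- by move: size_s; rewrite !size_cat /=; lia.
- by move: s_lt; rewrite !all_cat /= => /and3P[-> -> ->].
have walkE : perm_eq (walk (s1 ++ [:: v, v & s2])) (edge v v :: walk (s1 ++ v :: s2)).
  case: (s1) => [|u p]; first exact: perm_refl.
  by apply/permP => a; rewrite /walk /= !pairmap_cat /= !count_cat /=; lia.
move: s_uniq; rewrite !mask_cat //=; apply: etrans; apply: perm_uniq.
rewrite (permPl (perm_cat walkE (perm_refl _))) !map_cat.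
by apply/permP => a; rewrite /= !count_cat /=; lia.
Qed.

Lemma two_false (m : bitseq) : (2 * count id m).+1 < size m ->
  exists m1 m2, m = m1 ++ [:: false, false & m2].
Proof.
have [N] := ubnP (size m); elim: N m => // N IH [|[] m] //=; rewrite ltnS => ltN.
  rewrite add1n mulnS => Hm; have [|m1 [m2 ->]] := IH m ltN; first by lia.
  by exists (true :: m1), m2.
case: m ltN => [|[] m] //= ltN; last by exists [::], m.
rewrite add0n add1n mulnS => Hm; have [|m1 [m2 ->]] := IH m (ltnW ltN); first by lia.
by exists [:: false, true & m1], m2.
Qed.

(** Merging two adjacent unmarked positions into a marked one keeps [size m + count id m]; it is
    repeated until there are [c0] marks, and [loopy_split] undoes it. *)
Lemma loopy_descend k c0 : 4 < k -> c0 <= k ->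
    (forall m, size m + c0 = 'C(k, 2) + k -> count id m = c0 ->
       loopy k (rcons m false)) ->
  forall m, size m + count id m = 'C(k, 2) + k -> count id m <= c0 ->
    loopy k (rcons m false).
Proof.
move=> k_gt4 le_c0 H m size_m le_m.
have [d Ed] : exists d, c0 = count id m + d by exists (c0 - count id m); lia.
(* With fewer than k marks this bound leaves enough positions for two adjacent unmarked ones. *)
have bin_ge : 2 * k <= 'C(k, 2).+1.
  by rewrite bin2; have := half_leq (leq_mul (leqnn k) (_ : 4 <= k.-1)); lia.
elim: d m size_m le_m Ed => [|d IH] m size_m le_m Ed.
  by apply: H; rewrite ?Ed ?addn0 // -size_m.
have [|m1 [m2 Em]] := @two_false m; first by lia.
rewrite {}Em in size_m le_m Ed *; rewrite -cats1 -catA; apply: loopy_split.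
suff : loopy k (rcons (m1 ++ true :: m2) false) by rewrite -cats1 -catA.
by apply: IH; move: size_m le_m Ed; rewrite !size_cat !count_cat /=; lia.
Qed.

(** * Trails with legs and the small cases *)

Definition positions (m : bitseq) := mask m (iota 0 (size m)).

(* The legs are listed by the positions [ps] on the trail [s] at which they are
   attached and by their other endpoints [q]. *)
Definition trail_edges (s ps q : seq nat) :=
  walk s ++ [seq edge (nth 0 s p.1) p.2 | p <- zip ps q].

Definition good_trail k l ps s q :=
  [&& size s == l.+1, size q == size ps, all (gtn k) s, all (gtn k) q &
      uniq (trail_edges s ps q)].

Lemma loopy_trail k m : loopy k (rcons m false) ->
  exists s q, good_trail k (size m) (positions m) s q.
Proof.
case=> s [size_s s_lt s_uniq]; rewrite size_rcons in size_s.
exists s, [seq nth 0 s p | p <- positions m].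
have lt_pos p : p \in positions m -> p < size m.
  by move/mem_mask; rewrite mem_iota.
apply/and5P; split; rewrite ?size_s ?size_map //.
  apply/allP=> _ /mapP[p /lt_pos lt_p ->]; apply: (allP s_lt).
  by rewrite mem_nth // size_s leqW.
rewrite /trail_edges; move: s_uniq.
have -> : mask (rcons m false) s = [seq nth 0 s p | p <- positions m].
  rewrite -[s in LHS](@mkseq_nth _ 0) size_s /mkseq -map_mask; congr map.
  by rewrite -[(size m).+1]addn1 iotaD add0n cats1 mask_rcons ?size_iota // cats0.
suff -> : [seq edge v v | v <- [seq nth 0 s p | p <- positions m]] =
    [seq edge (nth 0 s p.1) p.2 | p <- zip (positions m) [seq nth 0 s p | p <- positions m]].
  by [].
by elim: (positions m) => //= p ps ->.
Qed.

(** Reduces to the extremal case: all attachment points lie before [l], so a prefix of the trail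
    keeps every leg. *)
Lemma good_trail_take k l l' ps s q : l <= l' -> all (gtn l) ps ->
  good_trail k l' ps s q -> good_trail k l ps (take l.+1 s) q.
Proof.
move=> le_l ps_lt /and5P[/eqP size_s size_q s_lt q_lt s_uniq].
apply/and5P; split=> //.
- by rewrite size_takel // size_s ltnS.
- by apply/allP=> v /mem_take; apply: (allP s_lt).
apply: subseq_uniq s_uniq; apply: cat_subseq.
  rewrite /walk; case: (s) => //= u s'; rewrite -{2}(cat_take_drop l s') pairmap_cat.
  exact: prefix_subseq.
rewrite (_ : map _ _ = [seq edge (nth 0 s p.1) p.2 | p <- zip ps q]) //.
apply/eq_in_map => -[p v] /(map_f fst); rewrite -/(unzip1 _) unzip1_zip ?(eqP size_q) //=.
by move/(allP ps_lt)=> lt_p; rewrite nth_take // ltnW.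
Qed.

Lemma sorted_positions l ps : sorted ltn ps -> all (gtn l) ps ->
  positions (mkseq (fun p => p \in ps) l) = ps.
Proof.
move=> ps_sorted ps_lt; rewrite /positions size_mkseq -filter_mask.
apply: (irr_sorted_eq ltn_trans ltnn) => //.
  by apply: sorted_filter (iota_ltn_sorted _ _); exact: ltn_trans.
move=> p; rewrite mem_filter mem_iota /= andb_idr // => /(allP ps_lt).
by [].
Qed.

Lemma count_positions m : size (positions m) = count id m.
Proof. by rewrite size_mask // size_iota. Qed.

(** The markings from which [loopy_split] produces [m]. *)
Definition merges m :=
  [seq take i m ++ true :: drop i.+2 m | i <- iota 0 (size m).-1
    & ~~ nth false m i && ~~ nth false m i.+1].

(** For k = 5 not every choice of five positions is served by [circuits5], but each marking with
    four marks has a merge that is; the descent therefore starts from four marks. *)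
Lemma hosts5_merges : all (fun m => has hosts5 (merges m)) (masks 11 4).
Proof. by vm_compute. Qed.

Lemma loopy5 m : size m = 11 -> count id m = 4 -> loopy 5 (rcons m false).
Proof.
move=> size_m count_m; have := mem_masks m; rewrite size_m count_m.
move/(allP hosts5_merges)/hasP=> [_ /mapP[i + ->] /hosts5P].
rewrite mem_filter mem_iota size_m /= => /andP[/andP[mi mi1] lt_i] hosts_m.
have Em : rcons m false = take i m ++ [:: false, false & rcons (drop i.+2 m) false].
  rewrite -{1}(cat_take_drop i m) (drop_nth false) ?size_m 1?ltnW //.
  by rewrite (drop_nth false) ?size_m // (negPf mi) (negPf mi1) -cats1 -catA /= cats1.
rewrite Em; apply: loopy_split.
suff : loopy 5 (rcons (take i m ++ true :: drop i.+2 m) false).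
  by rewrite -cats1 -catA /= cats1.
apply: hosts_loopy hosts_m; rewrite size_cat /= ?addnS //.
rewrite size_takel ?size_drop ?size_m; last by apply: ltnW (ltnW _).
by move: lt_i; clear; rewrite (_ : 'C(5, 2) = 10) //; lia.
Qed.

(* Trails and leg ends for k = 1, 3 and for the caterpillars with k = m = 5 that
   [circuits5] does not settle. *)
Definition extra_trails : seq (seq nat * seq nat) := [::
  ([:: 0; 0], [::]);
  ([:: 0; 0; 1; 1; 2; 2; 0], [::]);
  ([:: 0; 0; 2; 2; 1; 1], [:: 1]); ([:: 0; 0; 1; 2; 2; 0], [:: 1]);
  ([:: 0; 1; 1; 2; 0; 0], [:: 2]); ([:: 0; 0; 1; 1; 2; 0], [:: 2]);
  ([:: 0; 0; 2; 1; 1], [:: 1; 2]); ([:: 0; 0; 1; 2; 0], [:: 1; 2]);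
  ([:: 0; 0; 2; 1; 1; 4; 4; 2; 3; 3; 4], [:: 1; 2; 3; 0; 0]);
  ([:: 0; 0; 2; 1; 1; 4; 0; 3; 3; 4; 2], [:: 1; 2; 3; 4; 2]);
  ([:: 0; 0; 2; 1; 1; 3; 3; 2; 4; 4; 3], [:: 1; 2; 0; 0; 1]);
  ([:: 0; 0; 2; 1; 3; 2; 4; 4; 0; 3; 4], [:: 1; 1; 3; 2; 1]);
  ([:: 0; 0; 2; 1; 1; 4; 0; 3; 2; 4; 3], [:: 1; 3; 4; 3; 2]);
  ([:: 0; 0; 2; 1; 1; 3; 0; 4; 4; 2; 3], [:: 1; 3; 1; 3; 2]);
  ([:: 0; 0; 1; 2; 0; 3; 3; 2; 4; 4; 1], [:: 1; 2; 1; 4; 0]);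
  ([:: 0; 0; 1; 2; 0; 4; 2; 3; 3; 4; 1], [:: 1; 3; 4; 2; 1]);
  ([:: 0; 0; 1; 2; 3; 0; 2; 4; 4; 3; 1], [:: 1; 4; 2; 1; 3]);
  ([:: 0; 0; 1; 1; 3; 0; 2; 3; 4; 4; 2], [:: 2; 4; 2; 3; 1])].

Definition extra k m :=
  has (fun sq => good_trail k (size m) (positions m) sq.1 sq.2) extra_trails.

(** The first two alternatives are the markings outside the theorem: a leg at y_0, and
    CP_4^{1,3}. *)
Definition extra_cover k m :=
  [|| nth false m 0, m == [:: false; true; false; true], extra k m
    | (k == 5) && hosts5 m].

Lemma extra_covers : all (fun lcs => all (extra_cover lcs.1) (masks lcs.2.1 lcs.2.2))
  [:: (1, (1, 0)); (3, (6, 0)); (3, (5, 1)); (3, (4, 2)); (3, (3, 3)); (5, (10, 5))].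
Proof. by vm_compute. Qed.

Lemma extra_trail k m : (k, (size m, count id m)) \in
    [:: (1, (1, 0)); (3, (6, 0)); (3, (5, 1)); (3, (4, 2)); (3, (3, 3)); (5, (10, 5))] ->
  nth false m 0 = false -> m != [:: false; true; false; true] ->
  exists s q, good_trail k (size m) (positions m) s q.
Proof.
move=> m_in m0 ne_m; have /allP/(_ _ (mem_masks m)) := allP extra_covers _ m_in.
rewrite /extra_cover m0 (negPf ne_m) /=; case/orP.
  by case/hasP=> -[s q] _ sq_good; exists s, q.
case/andP=> /eqP k5 /hosts5P hosts_m; rewrite k5 in m_in *.
move: m_in; rewrite !inE !xpair_eqE /= => /andP[/eqP size_m _].
by apply/loopy_trail/hosts_loopy; rewrite ?size_m.
Qed.

(** For k >= 7 the descent starts from k marks, for k = 5 from four; five marks with k = 5, and all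
    of k = 1 and k = 3, are finite checks. *)
Lemma trail_exists k l ps : odd k -> 0 < l -> all (fun a => 0 < a < l) ps ->
    sorted ltn ps -> size ps <= k -> ~ (l = 4 /\ ps = [:: 1; 3]) ->
    l + size ps = 'C(k.+1, 2) ->
  exists s q, good_trail k l ps s q.
Proof.
move=> k_odd l_gt0 ps_range ps_sorted le_k not13; rewrite binS bin1 => total.
pose m := mkseq (fun p => p \in ps) l.
have ps_lt : all (gtn l) ps by apply: sub_all ps_range => p /andP[].
have size_m : size m = l by rewrite size_mkseq.
have Eps : positions m = ps by exact: sorted_positions.
have count_m : count id m = size ps by rewrite -count_positions Eps.
have m0 : nth false m 0 = false.
  by rewrite nth_mkseq //; apply/negP=> /(allP ps_range).
have m_not13 : m != [:: false; true; false; true].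
  by apply/eqP=> Em; apply: not13; rewrite -size_m -Eps Em.
have [h Ek] : exists h, k = (2 * h).+1.
  by exists k./2; rewrite -{1}(odd_double_half k) k_odd mul2n.
rewrite -count_m -size_m in total le_k; rewrite -size_m -Eps.
have [h_le2|h_gt2] := leqP h 2; last first.
  apply: loopy_trail; apply: (loopy_descend (c0 := k)) => //; first by rewrite Ek; lia.
  move=> m' size_m' count_m'.
  have size_m'' : size m' = 'C(k, 2) by apply: (@addIn k).
  apply: hosts_loopy => //; first by rewrite size_m'' Ek bin2_odd; nia.
  by rewrite Ek in size_m'' count_m' *; exact: transversal_odd.
have size_gt0 : 0 < size m by rewrite size_m.
case: h Ek h_le2 => [|[|[|h]]] // Ek _; rewrite {}Ek in total le_k *.
- have tot : size m + count id m = 1 := total.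
  have [Es Ec] : size m = 1 /\ count id m = 0 by move: size_gt0 tot; clear; lia.
  by apply: extra_trail => //; rewrite Es Ec.
- have tot : size m + count id m = 6 := total.
  apply: extra_trail => //; have Es : size m = 6 - count id m by move: tot; clear; lia.
  by rewrite Es; case: (count id m) le_k => [|[|[|[|]]]].
have tot : size m + count id m = 15 := total.
have [le4|gt4] := leqP (count id m) 4; last first.
  have [Es Ec] : size m = 10 /\ count id m = 5 by move: le_k gt4 tot; clear; lia.
  by apply: extra_trail => //; rewrite Es Ec.
apply: loopy_trail; apply: (loopy_descend (c0 := 4)) => //.
by move=> m' size_m' count_m'; apply: loopy5 => //; apply: (@addIn 4).
Qed.

(** * Edges of caterpillars and embeddings *)

Lemma set2_inj (T : finType) (a b c d : T) :
  [set a; b] = [set c; d] -> (a = c /\ b = d) \/ (a = d /\ b = c).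
Proof.
move=> E.
have := set21 a b; have := set22 a b; have := set21 c d; have := set22 c d.
rewrite {1 2}E -{1 2}E !in_set2.
by do 4!case/orP=> /eqP ?; subst; auto.
Qed.

Lemma mem_edges (T : finType) (e : rel T) x y : e x y -> [set x; y] \in edges e.
Proof. by move=> exy; apply/imsetP; exists (x, y); rewrite ?inE. Qed.

(* Arc number t of the caterpillar joins y_(t+1) to y_(parent t). *)
Definition parent l (i : seq nat) t := if t < l then t else nth 0 i (t - l).

Lemma parent_le l m (i : m.-tuple nat) t : all (fun a => 0 < a < l) i ->
  t < l + m -> parent l i t <= t.
Proof.
rewrite /parent => i_range lt_t; case: (ltnP t l) => // le_lt.
have /(allP i_range)/andP[_ /ltnW] : nth 0 i (t - l) \in val i.
  by rewrite mem_nth // size_tuple; lia.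
by move/leq_trans; apply.
Qed.

Definition child n (t : 'I_n) : 'I_n.+1 := lift ord0 t.
Definition parent_ord l m (i : m.-tuple nat) (t : 'I_(l + m)) : 'I_(l + m).+1 :=
  inord (parent l i t).

Lemma val_parent l m (i : m.-tuple nat) (t : 'I_(l + m)) :
  all (fun a => 0 < a < l) i -> parent_ord i t = parent l i t :> nat.
Proof.
move=> i_range; rewrite inordK // ltnS.
by rewrite (leq_trans (parent_le i_range (ltn_ord t))) // ltnW.
Qed.

Lemma caterpillar_parent l m (i : m.-tuple nat) (t : 'I_(l + m)) :
  all (fun a => 0 < a < l) i -> caterpillar l i (parent_ord i t) (child t).
Proof.
move=> i_range.
rewrite /caterpillar /caterpillar_arc val_parent // /parent /= /bump /= add1n.
case: (ltnP t l) => [lt_t|le_t]; first by rewrite lt_t eqxx.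
have lt_j : t - l < m by have := ltn_ord t; lia.
apply/orP; right; apply/orP; right; apply/existsP; exists (Ordinal lt_j) => /=.
by rewrite (tnth_nth 0) /= eqxx andbT; apply/eqP; lia.
Qed.

Lemma caterpillarP l m (i : m.-tuple nat) (x y : 'I_(l + m).+1) :
    all (fun a => 0 < a < l) i -> caterpillar l i x y ->
  exists t, [set x; y] = [set parent_ord i t; child t].
Proof.
move=> i_range.
have arcP (u v : 'I_(l + m).+1) : caterpillar_arc l i u v ->
    exists t, [set u; v] = [set parent_ord i t; child t].
  case/orP=> [/andP[lt_u /eqP Ev]|/existsP[j /andP[/eqP Eu /eqP Ev]]].
    have lt_t : u < l + m by rewrite -ltnS -Ev ltn_ord.
    exists (Ordinal lt_t).
    have -> : parent_ord i (Ordinal lt_t) = u.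
      by apply/val_inj; rewrite [LHS]val_parent // /parent lt_u.
    suff -> : child (Ordinal lt_t) = v by [].
    by apply/val_inj; rewrite /= Ev.
  have lt_t : l + j < l + m by rewrite ltn_add2l.
  exists (Ordinal lt_t); rewrite setUC.
  have -> : child (Ordinal lt_t) = u by apply/val_inj; rewrite /= Eu /bump /= addnS.
  suff -> : parent_ord i (Ordinal lt_t) = v by [].
  apply/val_inj; rewrite [LHS]val_parent // /parent /= Ev (tnth_nth 0).
  by rewrite ltnNge leq_addr addKn.
by case/orP=> /arcP[t Et]; exists t; rewrite // setUC.
Qed.

(** The parent has the smaller index, so the larger end of an edge is its child, which determines
    the arc. *)
Lemma parent_edge_inj l m (i : m.-tuple nat) : all (fun a => 0 < a < l) i ->
  injective (fun t : 'I_(l + m) => [set parent_ord i t; child t]).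
Proof.
move=> i_range.
have lt_pc (t : 'I_(l + m)) : (parent_ord i t < child t)%N.
  by rewrite val_parent //= /bump /= add1n ltnS parent_le.
move=> t u /set2_inj[[_ /lift_inj //]|[Epc Ecp]].
by have := lt_pc u; rewrite -Ecp -Epc ltnNge ltnW.
Qed.

(** These sets are the edges of K_k^*, loops being the singletons. *)
Lemma card_small_sets k :
  #|[set E : {set 'I_k} | 0 < #|E| <= 2]| = 'C(k.+1, 2).
Proof.
have -> : [set E : {set 'I_k} | 0 < #|E| <= 2] =
    [set E : {set 'I_k} | #|E| == 2] :|: [set E : {set 'I_k} | #|E| == 1].
  by apply/setP=> E; rewrite !inE; case: #|E| => [|[|[|]]].
rewrite cardsU disjoint_setI0 ?cards0 ?subn0; last first.
  by rewrite -setI_eq0; apply/eqP/setP=> E; rewrite !inE; case: #|E| => [|[|[|]]].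
by rewrite !card_draws card_ord binS.
Qed.

Lemma embeddable_leq k l m (i : m.-tuple nat) :
  all (fun a => 0 < a < l) i -> embeddable (caterpillar l i) (Kstar k) ->
  l + m <= 'C(k.+1, 2).
Proof.
move=> i_range [f [_ f_inj]].
pose E t := f @: [set parent_ord i t; child t].
rewrite -card_small_sets -[l + m]card_ord -(card_imset _ (_ : injective E)).
  apply: subset_leq_card; apply/subsetP=> _ /imsetP[t _ ->]; rewrite inE /E.
  rewrite imsetU1 imset_set1 cards2; by case: (_ != _).
move=> t u Etu; apply: (parent_edge_inj i_range); apply: f_inj => //;
  exact/mem_edges/caterpillar_parent.
Qed.

(** Path vertices go to [s] and leaves to [q]. The arcs of the caterpillar are then sent, in order,
    to the entries of [trail_edges], so injectivity on edges is the uniqueness of that list. *)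
Lemma good_trail_embeddable k l m (i : m.-tuple nat) s q :
    all (fun a => 0 < a < l) i -> good_trail k l i s q ->
  embeddable (caterpillar l i) (Kstar k).
Proof.
move=> i_range /and5P[/eqP size_s /eqP size_q s_lt q_lt s_uniq].
rewrite size_tuple in size_q.
pose F y := if y <= l then nth 0 s y else nth 0 q (y - l.+1).
have F_lt (y : 'I_(l + m).+1) : F y < k.
  rewrite /F; case: (leqP y l) => [le_y|lt_y].
    by apply: (allP s_lt); rewrite mem_nth // size_s.
  by apply: (allP q_lt); rewrite mem_nth // size_q; have := ltn_ord y; lia.
exists (fun y => Ordinal (F_lt y)); split=> //.
have edge_nth (t : 'I_(l + m)) :
    nth (0, 0) (trail_edges s i q) t = edge (F (parent_ord i t)) (F (child t)).
  rewrite val_parent // /F /parent /= /bump /= add1n /trail_edges nth_cat.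
  rewrite size_pairmap size_behead size_s /=.
  have [lt_t|le_t] := ltnP t l.
    rewrite ltnW // /walk; case: (s) size_s => // u s' [size_s'].
    by rewrite (nth_pairmap 0) ?size_s' //= lt_t; case: (nat_of_ord t).
  have lt_j : t - l < m by have := ltn_ord t; lia.
  rewrite (nth_map (0, 0)) ?size_zip ?size_q ?size_tuple ?minnn //.
  rewrite nth_zip ?size_q ?size_tuple //= subSS.
  suff -> : nth 0 i (t - l) <= l by [].
  have /(allP i_range)/andP[_ /ltnW //] : nth 0 i (t - l) \in val i.
  by rewrite mem_nth // size_tuple.
have size_edges : size (trail_edges s i q) = l + m.
  rewrite size_cat size_map size_zip size_q size_tuple minnn.
  by rewrite size_pairmap size_behead size_s.
have edge_inj (t u : 'I_(l + m)) :
    edge (F (parent_ord i t)) (F (child t)) = edge (F (parent_ord i u)) (F (child u)) ->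
    t = u.
  rewrite -!edge_nth => /eqP; rewrite nth_uniq ?size_edges // => /eqP.
  exact: val_inj.
have edgesP E : E \in edges (caterpillar l i) ->
    exists t, E = [set parent_ord i t; child t].
  by case/imsetP=> -[x y]; rewrite inE /= => /(caterpillarP i_range)[t Et] ->; exists t.
move=> _ _ /edgesP[t ->] /edgesP[u ->].
rewrite !imsetU1 !imset_set1 => /set2_inj Etu; congr [set parent_ord i _; child _];
  by apply: edge_inj; case: Etu => -[[E1] [E2]]; rewrite E1 E2 // edgeC.
Qed.

Theorem theorem2p3 (k l m : nat) (i : m.-tuple nat)
    (k_odd : odd k) (l_gt0 : 0 < l) (le_mk : m <= k)
    (i_range : all (fun a => 0 < a < l) i) (i_incr : sorted ltn i)
    (not_CP4_13 : ~ (l = 4 /\ tval i = [:: 1; 3])) :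
  embeddable (caterpillar l i) (Kstar k) <-> l + m <= 'C(k.+1, 2).
Proof.
split=> [|le_lm]; first exact: embeddable_leq.
(* Lengthen the path until the edge count is extremal. *)
have [l' [le_l total]] : exists l', l <= l' /\ l' + m = 'C(k.+1, 2).
  by exists ('C(k.+1, 2) - m); lia.
have [||||||s [q sq_good]] := @trail_exists k l' i k_odd.
- exact: leq_trans le_l.
- by apply: sub_all i_range => a /andP[-> /leq_trans]; apply.
- exact: i_incr.
- by rewrite size_tuple.
(* Lengthening cannot produce CP_4^{1,3} from another caterpillar: a leg at 3 forces l >= 4
   already. *)
- case=> l'4 Ei; apply: not_CP4_13; split=> //; apply/eqP; rewrite eqn_leq.
  by rewrite -{1}l'4 le_l; move: i_range; rewrite Ei /= => /and3P[].
- by rewrite size_tuple.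
apply: (@good_trail_embeddable k l m i (take l.+1 s) q) => //.
by apply: good_trail_take sq_good => //; apply: sub_all i_range => a /andP[].
Qed.
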